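(* Let $\widetilde G=A\times G$ be a definable extension of a definable group $G$ by a definable abelian group $A$. Suppose $\widetilde H\le\widetilde G$ is an invariant subgroup of bounded index, and that $G^{00}=G^{000}$. Suppose in addition that $\widetilde H\cap A\cap\widetilde G^{00}$ is type-definable. Then $\widetilde H\cap A\supseteq\widetilde G^{00}\cap A$. (In particular: if $G^{00}=G^{000}$, then for any invariant $\widetilde H\leq\widetilde G$ of bounded index such that $\widetilde H\cap A$ is type-definable, one has $\widetilde G^{00}\cap A\subseteq\widetilde H\cap A$, without any assumptions on the 2-cocycle $h$ beyond definability.)
   Context: Conventions: we work in a monster model $\mathfrak C$ of a complete theory with infinite models (language of arbitrary cardinality): $\mathfrak C$ is $\kappa$-saturated and strongly $\kappa$-homogeneous for a sufficiently large cardinal $\kappa$. ''Small'' and ''bounded'' mean of cardinality $<\kappa$. ''Definable'', ''type-definable'', ''invariant'' mean without parameters (over $\emptyset$). For a definable group $G$, $G^{000}$ is the smallest invariant subgroup of bounded index and $G^{00}$ the smallest type-definable subgroup of bounded index (both over $\emptyset$). Definable extension: let $G$ be a definable group with a definable action on a definable abelian group $A$ by automorphisms, and let $h\colon G^2\to A$ be a definable 2-cocycle, i.e. for all $g,g_1,g_2,g_3\in G$: $h(g_1,g_2)+h(g_1g_2,g_3)=h(g_1,g_2g_3)+g_1\cdot h(g_2,g_3)$ and $h(g,e)=h(e,g)=0$. The definable extension of $G$ by $A$ given by these data is the group $\widetilde G=A\times G$ with multiplication $(a_1,g_1)\cdot(a_2,g_2)=(a_1+g_1\cdot a_2+h(g_1,g_2),\,g_1g_2)$.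 $A$ is identified with the normal subgroup $A\times\{e\}$ of $\widetilde G$. *)

(* Defs.v *)
From HB Require Import structures.
From mathcomp Require Import all_boot all_order all_algebra.
From mathcomp Require Import boolp classical_sets functions cardinality.

Set Implicit Arguments.
Unset Strict Implicit.
Unset Printing Implicit Defensive.

Import GRing.Theory.

Local Open Scope classical_set_scope.
Local Open Scope card_scope.

(* Cardinals are represented by sets (or by types K, via [set: K]). *)
Definition card_lt T U (A : set T) (B : set U) : Prop :=
  A #<= B /\ ~ (B #<= A).

Record language := Language {
  fsym : Type;
  fsym_arity : fsym -> nat;
  rsym : Type;
  rsym_arity : rsym -> nat }.

Inductive term (L : language) (V : Type) : Type :=
| TVar of V
| TApp (f : fsym L) of ('I_(fsym_arity f) -> term L V).

(* [formula L V]: formulas whose free variables belong to V. The variable bound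
   by FAll is None, so the free variables of [FAll p] are those of p except None. *)
Inductive formula (L : language) (V : Type) : Type :=
| FBot
| FEq of term L V & term L V
| FRel (r : rsym L) of ('I_(rsym_arity r) -> term L V)
| FImp of formula L V & formula L V
| FAll of formula L (option V).

Record structure (L : language) := Structure {
  carrier :> Type;
  fun_of : forall f : fsym L, ('I_(fsym_arity f) -> carrier) -> carrier;
  rel_of : forall r : rsym L, ('I_(rsym_arity r) -> carrier) -> Prop }.

Arguments fun_of {L} _ f a.
Arguments rel_of {L} _ r a.

Fixpoint eval (L : language) (M : structure L) (V : Type) (v : V -> M)
    (t : term L V) : M :=
  match t with
  | TVar x => v x
  | TApp f a => fun_of M f (fun i => eval v (a i))
  end.

Fixpoint sat (L : language) (M : structure L) (V : Type) (p : formula L V)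
    : (V -> M) -> Prop :=
  match p with
  | FBot => fun _ => False
  | FEq s t => fun v => eval v s = eval v t
  | FRel r a => fun v => rel_of M r (fun i => eval v (a i))
  | FImp p q => fun v => sat p v -> sat q v
  | FAll p => fun v => forall x : M, sat p (oapp v x)
  end.

Definition automorphism (L : language) (M : structure L) (s : M -> M) : Prop :=
  [/\ bijective s,
      forall (f : fsym L) a, s (fun_of M f a) = fun_of M f (s \o a)
    & forall (r : rsym L) a, rel_of M r a <-> rel_of M r (s \o a)].

Section Monster.
Variables (K : Type) (L : language) (C : structure L).

(* Elements of [formula L (option B)] are formulas over the parameter set B in
   one free variable None; q ranges over the finite parts of the 1-type p. *)
Definition saturated : Prop :=
  forall B : set C, card_lt B [set: K] ->
  forall p : set (formula L (option B)),
    (forall q, finite_set q -> q `<=` p ->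
       exists x : C, forall phi, q phi -> sat phi (oapp (fun b : B => \val b) x)) ->
  exists x : C, forall phi, p phi -> sat phi (oapp (fun b : B => \val b) x).

Definition elementary (B : set C) (f : C -> C) : Prop :=
  forall phi : formula L B,
    sat phi (fun b : B => \val b) <-> sat phi (fun b : B => f (\val b)).

Definition strongly_homogeneous : Prop :=
  forall (B : set C) (f : C -> C), card_lt B [set: K] -> elementary B f ->
  exists2 s, automorphism s & {in B, s =1 f}.

(* The complete theory is Th(C), and |T| = |L| + aleph_0 is the number of
   L-sentences. "Sufficiently large" is read as kappa > 2^|T|, the bound that
   makes the connected components below have bounded index. *)
Definition monster : Prop :=
  [/\ infinite_set [set: C],
      card_lt [set: set (formula L void)] [set: K],
      saturated & strongly_homogeneous].

End Monster.

Section Definable.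
Variables (L : language) (C : structure L).

Definition definable (X : Type) (S : set (X -> C)) : Prop :=
  exists phi : formula L X, S = [set a | sat phi a].

Definition type_definable (X : Type) (S : set (X -> C)) : Prop :=
  exists Phi : set (formula L X), S = [set a | forall phi, Phi phi -> sat phi a].

Definition aut_invariant (X : Type) (S : set (X -> C)) : Prop :=
  forall s, automorphism s -> forall a, S a -> S (s \o a).

(* A definable set is given as a type P with an injection cP : P -> (X -> C)
   whose range is definable; coord_pair embeds P * Q into C^X * C^Y = C^(X+Y). *)
Definition coord_pair (P Q X Y : Type) (cP : P -> X -> C) (cQ : Q -> Y -> C)
    (p : P * Q) (z : X + Y) : C :=
  match z with inl x => cP p.1 x | inr y => cQ p.2 y end.

Definition definable_map (P Q X Y : Type) (cP : P -> X -> C) (cQ : Q -> Y -> C)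
    (f : P -> Q) : Prop :=
  definable (range (fun p => coord_pair cP cQ (p, f p))).

Definition definable_group (G : groupType) (X : Type) (c : G -> X -> C) : Prop :=
  [/\ injective c, definable (range c)
    & definable_map (coord_pair c c) c (fun p => (p.1 * p.2)%g)].

Definition definable_abelian_group (A : zmodType) (Y : Type) (c : A -> Y -> C)
    : Prop :=
  [/\ injective c, definable (range c)
    & definable_map (coord_pair c c) c (fun p => (p.1 + p.2)%R)].

End Definable.

Definition subgroup (G : groupType) (H : set G) : Prop := group_closed (mem H).

Definition left_cosets (G : groupType) (H : set G) : set (set G) :=
  range (fun x : G => [set (x * y)%g | y in H]).

Definition bounded_index (K : Type) (G : groupType) (H : set G) : Prop :=
  card_lt (left_cosets H) [set: K].

Section Components.
Variables (K : Type) (L : language) (C : structure L).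
Variables (G : groupType) (X : Type) (c : G -> X -> C).

(* [smallest D set0] is the intersection of the family D; see [smallest_least]. *)
Definition comp00 : set G :=
  smallest [set H | [/\ subgroup H, type_definable (c @` H)
                      & bounded_index K H]] set0.

Definition comp000 : set G :=
  smallest [set H | [/\ subgroup H, aut_invariant (c @` H)
                      & bounded_index K H]] set0.

End Components.

Lemma smallest_least (T : Type) (D : set (set T)) (H : set T) :
  D H -> (forall H', D H' -> H `<=` H') -> smallest D set0 = H.
Proof.
move=> DH leH; apply/seteqP; split; first exact: smallest_sub.
by move=> x Hx H' [DH' _]; apply: leH Hx.
Qed.

Record extension_data (G : groupType) (A : zmodType) := ExtensionData {
  act : G -> A -> A;
  act1 : forall a, act 1%g a = a;
  actM : forall g1 g2 a, act (g1 * g2)%g a = act g1 (act g2 a);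
  actD : forall g a1 a2, act g (a1 + a2)%R = (act g a1 + act g a2)%R;
  cocycle : G -> G -> A;
  cocycleM : forall g1 g2 g3,
    (cocycle g1 g2 + cocycle (g1 * g2)%g g3
     = cocycle g1 (g2 * g3)%g + act g1 (cocycle g2 g3))%R;
  cocycleg1 : forall g, cocycle g 1%g = 0%R;
  cocycle1g : forall g, cocycle 1%g g = 0%R }.

Definition extension (G : groupType) (A : zmodType)
  (E : extension_data G A) : Type := (A * G)%type.

Section ExtensionGroup.
Variables (G : groupType) (A : zmodType) (E : extension_data G A).
Local Notation act := (act E).
Local Notation h := (cocycle E).
Implicit Types x y z : extension E.

Definition ext_one : extension E := (0%R, 1%g).

Definition ext_mul x y : extension E :=
  ((x.1 + act x.2 y.1 + h x.2 y.2)%R, (x.2 * y.2)%g).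

Definition ext_inv x : extension E :=
  ((- act x.2^-1%g x.1 - h x.2^-1%g x.2)%R, x.2^-1%g).

Let act0 g : act g 0%R = 0%R.
Proof. by apply: (addrI (act g 0%R)); rewrite -actD !addr0. Qed.

Let actN g a : act g (- a)%R = (- act g a)%R.
Proof. by apply: (addrI (act g a)); rewrite -actD !subrr act0. Qed.

Let ext_mulA : associative ext_mul.
Proof.
move=> [a1 g1] [a2 g2] [a3 g3]; rewrite /ext_mul /= mulgA; congr pair.
rewrite !actD actM -!addrA; congr (_ + (_ + _))%R.
by rewrite [RHS]addrCA cocycleM (addrC (act _ (h _ _))).
Qed.

Let ext_mul1x : left_id ext_one ext_mul.
Proof. by case=> a g; rewrite /ext_mul /= act1 cocycle1g mul1g add0r addr0. Qed.

Let ext_mulx1 : right_id ext_one ext_mul.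
Proof. by case=> a g; rewrite /ext_mul /= act0 cocycleg1 mulg1 !addr0. Qed.

Let ext_mulVx : left_inverse ext_one ext_inv ext_mul.
Proof.
case=> a g; rewrite /ext_mul /ext_inv /ext_one /= mulVg; congr pair.
by rewrite -opprD -addrA addNr.
Qed.

Let ext_mulxV : right_inverse ext_one ext_inv ext_mul.
Proof.
case=> a g; rewrite /ext_mul /ext_inv /ext_one /= mulgV; congr pair.
rewrite actD !actN -actM mulgV act1 addNKr.
have := cocycleM E g g^-1%g g.
by rewrite mulgV mulVg cocycle1g cocycleg1 addr0 add0r => ->; rewrite addNr.
Qed.

HB.instance Definition _ := Choice.copy (extension E) (A * G)%type.
HB.instance Definition _ := isGroup.Build (extension E)
  ext_mulA ext_mul1x ext_mulx1 ext_mulVx ext_mulxV.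

(* A, identified with A * {1}. *)
Definition ext_ker : set (extension E) := [set x | x.2 = 1%g].

Definition ext_coord (L : language) (C : structure L) (X Y : Type)
    (cA : A -> Y -> C) (cG : G -> X -> C) (x : extension E) : Y + X -> C :=
  coord_pair cA cG x.

End ExtensionGroup.

Arguments ext_ker {G A} E.
Arguments ext_coord {G A} E {L C X Y}.

(* Main.v *)
Require Import Defs.
From mathcomp Require Import all_boot all_order all_algebra.
From mathcomp Require Import boolp classical_sets functions cardinality.

(** Write N for the component 00 of the extension, p for its projection onto G, and
    let S be the subgroup of the extension constructed below ([core_group]).  It is
    the union of an increasing sequence F_0, F_1, F_2, ... of type-definable
    symmetric sets with F_n F_n = F_(n+1), it has bounded index, and it lies in
    every invariant subgroup of bounded index; so S is contained in both H and N.

    The image p(S) is the smallest invariant subgroup of bounded index of G, hence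
    it is also G^00 and is type-definable.  The type-definable group
    N0 = p^-1(G^00) = S A is the union of the type-definable sets F_n A, and such an
    increasing union must stop ([tdset_union_stops], a theorem of Newelski on the
    generation of type-definable groups), so N0 = F_n A for some n.  Since
    N is contained in N0, an element x of the intersection of H and N is of the
    form f k with f in F_n and k in A; as F_n lies in H and in N, so does k.  This
    shows that the intersection of H and N is the product of F_n and of the
    intersection of H, A and N, both type-definable.  Being type-definable by
    compactness, and of bounded index because it contains S, it contains N.

    The first step, F_0, is the intersection of the thick definable sets: symmetric
    definable sets D containing 1 for which the size of the sets whose distinct
    elements x, y satisfy x^-1 y notin D is bounded by an integer.  That F_0 lies in
    every invariant subgroup of bounded index ([core0_sub]) is proved by extending a
    set of elements with pairwise quotients of the type of some a in F_0 outside
    the subgroup, up to symmetry, by saturation, until it has too many elements.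
    For each thick set D, finitely many translates of D cover the group; x^-1 y is
    in F_0 F_0 when x and y belong to the same ones among these translates, because
    thick sets are stable under intersection by Ramsey's theorem.  This shows that
    S has bounded index ([core_group_bounded]).

    The union stops because of a Baire category argument in a minimal flow of types,
    made combinatorial: the role of the sets that miss the minimal flow is played by
    a maximal family Z of sets such that no finite union of translates of members
    of Z covers N0. *)

Set Implicit Arguments.
Unset Strict Implicit.
Unset Printing Implicit Defensive.

Local Open Scope classical_set_scope.
Local Open Scope card_scope.

(** * Set theory *)

(** Tukey's lemma: for a property of finite character there is a maximal set all
    of whose finite subsets have it. *)
Lemma tukey (T : eqType) (Q : seq T -> Prop) :
  Q [::] ->
  let good Z := forall s : seq T, (forall x, x \in s -> Z x) -> Q s in
  exists Z : set T, good Z /\ forall x, good (x |` Z) -> Z x.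
Proof.
move=> Qnil good.
have [F goodF totF|Z [gZ maxZ]] := @Zorn_bigcup T good.
  move=> s sF.
  have [->|[X FX sX]] : s = [::] \/ exists2 X, F X & forall x, x \in s -> X x.
    elim: s sF => [|x s IH] sF; [by left | right].
    have [X FX Xx] := sF x (mem_head _ _).
    have [y ys|s0|[Y FY sY]] := IH; first by apply: sF; rewrite inE ys orbT.
      by exists X => // y; rewrite s0 inE => /eqP ->.
    have [XY|YX] := totF _ _ FX FY.
      by exists Y => // y; rewrite inE => /orP[/eqP -> | /sY //]; apply: XY.
    by exists X => // y; rewrite inE => /orP[/eqP -> // | /sY]; apply: YX.
  - exact: Qnil.
  - exact: goodF FX _ sX.
exists Z; split=> // x gx; apply: contrapT => Zx.
apply: (maxZ (x |` Z)) => //; split; first by move=> y; right.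
by move=> /(_ x)/(_ (or_introl erefl)).
Qed.

Lemma inj_card_leT (I J : Type) (f : I -> J) :
  injective f -> [set: I] #<= [set: J].
Proof.
move=> finj; have /injfunPex[g] : exists2 f : I -> J,
  set_fun [set: I] [set: J] f & set_inj [set: I] f.
  by exists f => // x y _ _; apply: finj.
exact: inj_card_le g.
Qed.

Lemma card_leT_inj (I J : Type) :
  [set: I] #<= [set: J] -> exists f : I -> J, injective f.
Proof.
move=> /card_leP[g]; pose e (x : I) : [set: I] := SigSub (mem_set (Logic.I : setT x)).
exists (fun x => val (g (e x))) => x y /val_inj/(@inj _ _ _ g).
by move=> /(_ (mem_set Logic.I) (mem_set Logic.I)) [].
Qed.

(** An infinite set is covered, up to a finite remainder, by a maximal disjoint
    family of injective sequences; absorbing the remainder in one of them and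
    splitting every sequence gives [U * nat <= U]. *)
Lemma infinite_prod_nat_le (U : Type) :
  infinite_set [set: U] -> [set: U * nat] #<= [set: U].
Proof.
move=> infU.
pose Q (s : seq {classic nat -> U}) := (forall f, f \in s -> injective f) /\
  forall f g i j, f \in s -> g \in s -> f i = g j -> f = g.
(* F: a maximal family of injective sequences with disjoint ranges *)
have [//|F [goodF maxF]] := @tukey _ Q.
have Finj f : F f -> injective f.
  by move=> Ff; apply: (proj1 (goodF [:: f] _)); rewrite ?mem_head // => g;
     rewrite inE => /eqP ->.
have Fdisj f g i j : F f -> F g -> f i = g j -> f = g.
  move=> Ff Fg; apply: (proj2 (goodF [:: f; g] _)); rewrite ?inE ?eqxx ?orbT //.
  by move=> h; rewrite !inE => /orP[] /eqP ->.
(* R: the points outside all these ranges *)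
pose R := [set x | forall f i, F f -> x <> f i].
have finR : finite_set R.
  apply: contrapT => /infiniteP/card_leP[g].
  pose h (i : nat) : U := val (g (SigSub (mem_set (Logic.I : setT i)))).
  have hR i : R (h i) by apply: set_mem; apply: (valP (g _)).
  have hinj : injective h.
    move=> i j /val_inj/(@inj _ _ _ g).
    by move=> /(_ (mem_set Logic.I) (mem_set Logic.I)) [].
  suff Fh : F h by have := hR 0; move=> /(_ h 0 Fh).
  apply: maxF => s sF; split=> [f /sF[->//|/Finj//]|f g' i j].
  move=> /sF[->|Ff] /sF[->|Fg] //; last exact: Fdisj.
    by move=> e; case: (hR i g' j Fg).
  by move=> e; case: (hR j f i Ff).
have [f0 Ff0] : exists f0, F f0.
  apply: contrapT => nF; apply: infU; apply: sub_finite_set finR => x _ f i Ff.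
  by case: nF; exists f.
have /pcard_injP[r rinj] : R #<= [set: nat] by apply: finite_set_countable.
(* e encodes x by a sequence of F and an index; the odd indices are the terms of
   that sequence and the even indices of f0 are used for R *)
pose e_spec x (p : (nat -> U) * nat) := F p.1 /\
  ((exists2 i, x = p.1 i & p.2 = i.*2.+1) \/ [/\ R x, p.1 = f0 & p.2 = (r x).*2]).
have /choice[e eP] x : exists p, e_spec x p.
  have [Rx|nRx] := pselect (R x); first by exists (f0, (r x).*2); split=> //; right.
  apply: contrapT => ne; apply: nRx => f i Ff xE; apply: ne.
  by exists (f, i.*2.+1); split=> //; left; exists i.
have einj x y : e x = e y -> x = y.
  move=> exy; have [_ hx] := eP x; have [_ hy] := eP y; rewrite -exy in hy.
  case: hx hy => [[i xE ei] | [Rx _ ex]] [[j yE ej] | [Ry _ ey]].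
  - by move: ei; rewrite ej => -[] /double_inj ij; rewrite xE yE ij.
  - by move/(congr1 odd): ei; rewrite ey /= !odd_double.
  - by move/(congr1 odd): ex; rewrite ej /= !odd_double.
  - by apply: rinj; rewrite ?inE //; apply: double_inj; rewrite -ex -ey.
apply: (@inj_card_leT _ _ (fun p => (e p.1).1 (pickle ((e p.1).2, p.2)))).
move=> [x n] [y m] /= fE.
have e1 := Fdisj _ _ _ _ (eP x).1 (eP y).1 fE.
move: fE; rewrite e1 => /(Finj _ (eP y).1)/(pcan_inj pickleK)[e2 ->].
by rewrite (einj x y) //; move: e1 e2; case: (e x) (e y) => [? ?] [? ?] /= -> ->.
Qed.

(** Ramsey's theorem for two symmetric relations. *)
Lemma ramsey (T : eqType) (U1 U2 : T -> T -> Prop) :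
  (forall x y, U1 x y -> U1 y x) -> (forall x y, U2 x y -> U2 y x) ->
  forall m1 m2, exists n, forall s : seq T, uniq s -> n <= size s ->
  (forall x y, x \in s -> y \in s -> x <> y -> U1 x y \/ U2 x y) ->
  (exists t, [/\ uniq t, size t = m1, {subset t <= s}
     & forall x y, x \in t -> y \in t -> x <> y -> U1 x y]) \/
  (exists t, [/\ uniq t, size t = m2, {subset t <= s}
     & forall x y, x \in t -> y \in t -> x <> y -> U2 x y]).
Proof.
move=> sym1 sym2 m1 m2; move: {2}(m1 + m2) (leqnn (m1 + m2)) => k.
have triv (U : T -> T -> Prop) s : exists t, [/\ uniq t, size t = 0,
    {subset t <= s} & forall x y, x \in t -> y \in t -> x <> y -> U x y].
  by exists [::].
elim: k m1 m2 => [|k IH] [|m1] [|m2] //; try by exists 0 => *; left.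
  by exists 0 => *; right.
rewrite addSn addnS ltnS => lek.
have [n1 h1] := IH m1 m2.+1 ltac:(by rewrite addnS).
have [n2 h2] := IH m1.+1 m2 ltac:(by rewrite addSn).
exists (n1 + n2).+1 => -[//|x s] /= /andP[xs us]; rewrite ltnS => ns hs.
pose a := [pred y | `[< U1 x y >]].
have sub p : {subset filter p s <= x :: s}.
  by move=> y; rewrite mem_filter inE => /andP[_ ->]; rewrite orbT.
have cl p y z : y \in filter p s -> z \in filter p s -> y <> z -> U1 y z \/ U2 y z.
  by move=> /sub yi /sub zi; apply: hs.
have [le1|lt1] := leqP n1 (size (filter a s)).
  have ha y : y \in filter a s -> U1 x y by rewrite mem_filter => /andP[/asboolP].
  case: (h1 (filter a s)); rewrite ?filter_uniq //; first exact: cl.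
    move=> [t [ut st ts tU]]; left; exists (x :: t); split=> //=.
    - by rewrite ut andbT; apply: contra xs => /ts; rewrite mem_filter => /andP[].
    - by rewrite st.
    - by move=> y; rewrite inE => /orP[/eqP ->|/ts/sub//]; rewrite mem_head.
    - move=> y z; rewrite !inE => /orP[/eqP ->|yt] /orP[/eqP ->|zt] // yz.
      + by apply/ha/ts.
      + by apply/sym1/ha/ts.
      + exact: tU.
  by move=> [t [ut st ts tU]]; right; exists t; split=> // y /ts/sub.
have le2 : n2 <= size (filter (predC a) s).
  move: ns lt1; rewrite !size_filter -(count_predC a s) => ns lt1.
  by rewrite -(leq_add2l n1) (leq_trans ns) // leq_add2r ltnW.
have ha y : y \in filter (predC a) s -> U2 x y.
  rewrite mem_filter => /andP[/asboolPn nU1 ys].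
  by case: (hs x y) => //; rewrite ?inE ?eqxx ?ys ?orbT // => xy; case/negP: xs; rewrite xy.
case: (h2 (filter (predC a) s)); rewrite ?filter_uniq //; first exact: cl.
  by move=> [t [ut st ts tU]]; left; exists t; split=> // y /ts/sub.
move=> [t [ut st ts tU]]; right; exists (x :: t); split=> //=.
- by rewrite ut andbT; apply: contra xs => /ts; rewrite mem_filter => /andP[].
- by rewrite st.
- by move=> y; rewrite inE => /orP[/eqP ->|/ts/sub//]; rewrite mem_head.
- move=> y z; rewrite !inE => /orP[/eqP ->|yt] /orP[/eqP ->|zt] // yz.
  + by apply/ha/ts.
  + by apply/sym2/ha/ts.
  + exact: tU.
Qed.

(** * Definable relations *)

(** Renaming of variables. *)
Fixpoint ren_term (L : language) (V W : Type) (u : V -> W) (t : term L V) :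
    term L W :=
  match t with
  | TVar x => TVar L (u x)
  | TApp f a => TApp (fun i => ren_term u (a i))
  end.

Fixpoint ren (L : language) (V : Type) (p : formula L V) :
    forall W : Type, (V -> W) -> formula L W :=
  match p with
  | FBot => fun W _ => FBot L W
  | FEq s t => fun W u => FEq (ren_term u s) (ren_term u t)
  | FRel r a => fun W u => FRel (fun i => ren_term u (a i))
  | FImp p q => fun W u => FImp (ren p u) (ren q u)
  | FAll p => fun W u => FAll (ren p (omap u))
  end.

(** Juxtaposition of two families. *)
Definition sumf (T V W : Type) (a : V -> T) (b : W -> T) (z : V + W) : T :=
  match z with inl x => a x | inr y => b y end.

Lemma funext_option (T V : Type) (f g : option V -> T) :
  f None = g None -> (forall x, f (Some x) = g (Some x)) -> f = g.
Proof. by move=> fgN fgS; apply/funext => -[]. Qed.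

Lemma funext_sum (T V W : Type) (f g : V + W -> T) :
  (forall x, f (inl x) = g (inl x)) -> (forall y, f (inr y) = g (inr y)) -> f = g.
Proof. by move=> fgl fgr; apply/funext => -[]. Qed.

(** Induction on the cardinality of a finite type, one element at a time. *)
Lemma fin_type_ind (P : Type -> Prop) :
  (forall (V W : Type) (f : V -> W), bijective f -> P V -> P W) ->
  P void -> (forall V : finType, P V -> P (option V)) -> forall X : finType, P X.
Proof.
move=> Pbij P0 PS X.
apply: (Pbij 'I_#|X| X enum_val); first exact: enum_val_bij.
elim: #|X| => [|n IH].
  apply: (Pbij _ _ (fun x : void => match x with end)) P0.
  by exists (fun i : 'I_0 => False_rect _ (notF (ltn_ord i))) => -[].
apply: (Pbij _ _ (fun o => oapp (lift ord0) ord0 o)) (PS _ IH).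
exists (unlift ord0) => [[i|]|i] /=; rewrite ?liftK ?unlift_none //.
by case: unliftP => [j ->|->].
Qed.

Section Definability.
Variables (L : language) (C : structure L).

Lemma eval_ren V W (u : V -> W) (t : term L V) (v : W -> C) :
  eval v (ren_term u t) = eval (v \o u) t.
Proof.
by elim: t => [x|f a IH] //=; congr (fun_of C f _); apply/funext => i.
Qed.

Lemma sat_ren V W (p : formula L V) (u : V -> W) (v : W -> C) :
  sat (ren p u) v <-> sat p (v \o u).
Proof.
elim: p W u v => [{}V|{}V s t|{}V r a|{}V p IHp q IHq|{}V p IHp] W u v //=.
- by rewrite !eval_ren.
- by under eq_fun do rewrite eval_ren.
- by rewrite IHp IHq.
- split=> + x => /(_ x); rewrite IHp; congr (sat p _); by apply: funext_option => /=.
Qed.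

Lemma sat_automorphism (s : C -> C) : automorphism s ->
  forall V (p : formula L V) (v : V -> C), sat p (s \o v) <-> sat p v.
Proof.
move=> [[s' sK s'K] sf sr].
have evals V (v : V -> C) t : eval (s \o v) t = s (eval v t).
  elim: t => [x|f a IH] //=; rewrite sf; congr (fun_of C f _).
  by apply/funext => i; apply: IH.
move=> V p; elim: p => [{}V|{}V a b|{}V r a|{}V p IHp q IHq|{}V p IHp] v //=.
- by rewrite !evals; split=> [/(can_inj sK)|->].
- have -> : (fun i => eval (s \o v) (a i)) = s \o (fun i => eval v (a i)).
    by apply/funext => i; apply: evals.
  exact: iff_sym (sr _ _).
- by rewrite IHp IHq.
- split=> h x.
    by apply/IHp; have := h (s x); congr (sat p _); apply: funext_option.
  have := h (s' x); move/IHp; congr (sat p _); by apply: funext_option => /=.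
Qed.

(** Relations defined by a formula without parameters. *)
Definition defrel V (R : (V -> C) -> Prop) : Prop :=
  exists phi : formula L V, forall v, sat phi v <-> R v.

Lemma definableP V (S : set (V -> C)) : definable S <-> defrel S.
Proof.
split=> [[phi ->]|[phi h]]; exists phi => //.
by apply/seteqP; split=> v /h.
Qed.

Lemma defrel_ext V (R R' : (V -> C) -> Prop) :
  (forall v, R v <-> R' v) -> defrel R -> defrel R'.
Proof. by move=> RR' [phi h]; exists phi => v; rewrite h RR'. Qed.

Lemma defrel_imp V (R R' : (V -> C) -> Prop) :
  defrel R -> defrel R' -> defrel (fun v => R v -> R' v).
Proof. by move=> [p hp] [q hq]; exists (FImp p q) => v /=; rewrite hp hq. Qed.

Lemma defrel_not V (R : (V -> C) -> Prop) :
  defrel R -> defrel (fun v => ~ R v).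
Proof. by move=> [p hp]; exists (FImp p (FBot L V)) => v /=; rewrite hp. Qed.

Lemma defrel_true V : defrel (fun _ : V -> C => True).
Proof. by exists (FImp (FBot L V) (FBot L V)) => v /=; split. Qed.

Lemma defrel_and V (R R' : (V -> C) -> Prop) :
  defrel R -> defrel R' -> defrel (fun v => R v /\ R' v).
Proof.
move=> dR dR'; apply: defrel_ext (defrel_not (defrel_imp dR (defrel_not dR'))).
move=> v; split=> [h|[Rv R'v] h]; last exact: h Rv R'v.
by split; apply: contrapT => n; apply: h => Rv // R'v.
Qed.

Lemma defrel_eq V (x y : V) : defrel (fun v : V -> C => v x = v y).
Proof. by exists (FEq (TVar L x) (TVar L y)). Qed.

Lemma defrel_sub V W (u : V -> W) (R : (V -> C) -> Prop) :
  defrel R -> defrel (fun w : W -> C => R (w \o u)).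
Proof. by move=> [p hp]; exists (ren p u) => w; rewrite sat_ren hp. Qed.

Lemma defrel_ex1 V (R : (option V -> C) -> Prop) :
  defrel R -> defrel (fun v => exists x, R (oapp v x)).
Proof.
move=> [p hp].
have: defrel (fun v => forall x, ~ R (oapp v x)).
  exists (FAll (FImp p (FBot L _))) => v /=.
  by split=> h x; have := h x; rewrite hp.
by move/defrel_not; apply: defrel_ext => v; rewrite -existsNP; split=> -[x];
  [move/contrapT|move=> h]; exists x => //; apply.
Qed.

(** Quantification over a finite tuple. *)
Lemma defrel_ex (X : finType) V (R : (V + X -> C) -> Prop) :
  defrel R -> defrel (fun v => exists a : X -> C, R (sumf v a)).
Proof.
move: V R; apply: (fin_type_ind (P := fun X => forall V (R : (V + X -> C) -> Prop),
  defrel R -> defrel (fun v => exists a : X -> C, R (sumf v a)))) X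
  => [{}X Y f [g fK gK] IH||{}X IH] V R dR.
- have := IH _ _ (defrel_sub (fun z => match z with inl x => inl x
      | inr y => inr (g y) end) dR).
  apply: defrel_ext => v; split=> -[a Ra]; [exists (a \o g)|exists (a \o f)];
    move: Ra; congr (R _); apply: funext_sum => //= y; by rewrite gK.
- apply: defrel_ext (defrel_sub (fun z : V + void => match z with inl x => x
    | inr y => match y with end end) dR) => v.
  split=> [Rv|[a Ra]]; first exists (fun y : void => match y with end).
    by move: Rv; congr (R _); apply: funext_sum.
  by move: Ra; congr (R _); apply: funext_sum.
- pose u (z : V + option X) : option V + X := match z with
    | inl x => inl (Some x) | inr None => inl None | inr (Some y) => inr y end.
  have uE v (c : C) a : sumf (oapp v c) a \o u = sumf v (oapp a c).
    by apply: funext_sum => // -[].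
  apply: defrel_ext (defrel_ex1 (IH _ _ (defrel_sub u dR))) => v.
  split=> [[c [a Ra]]|[a Ra]]; first by exists (oapp a c); rewrite -uE.
  exists (a None), (a \o some); rewrite uE; move: Ra; congr (R _).
  by apply: funext_sum => // -[].
Qed.

End Definability.

(** * Saturation and homogeneity *)

Section Small.
Variable K : Type.

(** Types of cardinality less than that of [K]. *)
Definition small (I : Type) : Prop := card_lt [set: I] [set: K].

Lemma card_le_lt T U (A : set T) (B : set U) :
  A #<= B -> card_lt B [set: K] -> card_lt A [set: K].
Proof.
move=> AB [BK nKB]; split; first exact: card_le_trans AB BK.
by move=> KA; apply: nKB; apply: card_le_trans KA AB.
Qed.

Lemma small_inj (I J : Type) (f : I -> J) : injective f -> small J -> small I.
Proof. by move=> /inj_card_leT; apply: card_le_lt. Qed.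

Hypothesis smallN : small nat.

Lemma small_prod_nat (I : Type) : small I -> small (I * nat).
Proof.
move=> sI; have [finI|infI] := pselect (finite_set [set: I]).
  apply: (@card_le_lt _ _ _ [set: nat]) smallN.
  have /card_leT_inj[f finj] := finite_set_countable finI.
  apply: (inj_card_leT (f := fun p : I * nat => pickle (f p.1, p.2))).
  by move=> [x n] [y m] /= /(pcan_inj pickleK)[/finj -> ->].
exact: card_le_lt (infinite_prod_nat_le infI) sI.
Qed.

Lemma small_prod_count (I : Type) (J : countType) : small I -> small (I * J).
Proof.
move=> /small_prod_nat; apply: (small_inj (f := fun p => (p.1, pickle p.2))).
by move=> [x n] [y m] /= [-> /(pcan_inj pickleK) ->].
Qed.

Lemma small_count (J : countType) : small J.
Proof. exact: small_inj (pcan_inj pickleK) smallN. Qed.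

Lemma small_option (I : Type) : small I -> small (option I).
Proof.
have [[i0 _]|nI] := pselect (exists i : I, True); last first.
  move=> _; apply: (small_inj (f := fun=> 0)) smallN => -[i|] [j|] // _.
    by case: nI; exists i.
  - by case: nI; exists i.
  - by case: nI; exists j.
move=> /small_prod_nat; apply: (small_inj (f := fun o => oapp (pair^~ 1) (i0, 0) o)).
by move=> [i|] [j|] //= [->].
Qed.

End Small.

Section Saturation.
Variables (K : Type) (L : language) (C : structure L).
Hypothesis smallN : small K nat.
Hypothesis satC : saturated K C.

(** A family of sets in which any two members contain a common third one. *)
Definition directed (T : Type) (F : set (set T)) : Prop :=
  forall D1 D2, F D1 -> F D2 -> exists2 D, F D & D `<=` D1 `&` D2.

(** Saturation for directed families of sets defined with a small indexed family
    [b] of parameters. *)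
Lemma saturated1 (I : Type) (b : I -> C) (F : set (set C)) :
  small K I ->
  (forall D, F D -> exists R, defrel R /\ forall x, D x <-> R (oapp b x)) ->
  directed F -> (forall D, F D -> D !=set0) -> F !=set0 ->
  exists x, forall D, F D -> D x.
Proof.
move=> sI defF dirF neF [D0 FD0].
pose B := range b; pose v (i : B) : C := val i.
pose b' (i : I) : B := SigSub (mem_set (imageT b i)).
have vb' : v \o b' = b by [].
pose p : set (formula L (option B)) := [set phi | F [set x | sat phi (oapp v x)]].
have [|q /(@finite_seqP {classic (formula L (option B))})[s ->] sp|x px] :=
    satC (B := B) _ (p := p).
- by apply: card_le_lt sI; apply: card_image_le.
- suff [D FD Ds] : exists2 D, F D & forall phi, phi \in s ->
      forall x, D x -> sat phi (oapp v x).
    have [x Dx] := neF _ FD; exists x => phi phis; exact: Ds phis _ Dx.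
  elim: s sp => [|phi s IH] sp; first by exists D0.
  have [psi psis|D FD Ds] := IH; first by apply: sp; rewrite /= inE psis orbT.
  have [|D' FD' D'sub] := dirF _ _ FD (sp phi _); first by rewrite /= mem_head.
  exists D' => // psi; rewrite inE => /orP[/eqP ->|psis] x /D'sub[Dx] //.
  by move=> _; apply: Ds psis _ Dx.
exists x => D FD; have [R [[phi hphi] DR]] := defF D FD.
have key y : sat (ren phi (omap b')) (oapp v y) <-> D y.
  rewrite sat_ren DR -hphi; suff -> : oapp v y \o omap b' = oapp b y by [].
  by apply: funext_option.
apply/key/px; move: FD; congr (F _).
by apply/seteqP; split=> y /key.
Qed.

(** Saturation for finitely many variables: the coordinates are realized one after
    the other, each one being then added to the parameters. *)
Lemma saturated_fin (X : finType) (I : Type) (b : I -> C)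
    (F : set (set (X -> C))) :
  small K I ->
  (forall D, F D -> exists R, defrel R /\ forall a, D a <-> R (sumf a b)) ->
  directed F -> (forall D, F D -> D !=set0) -> F !=set0 ->
  exists a, forall D, F D -> D a.
Proof.
pose P X := forall I (b : I -> C) (F : set (set (X -> C))), small K I ->
  (forall D, F D -> exists R, defrel R /\ forall a, D a <-> R (sumf a b)) ->
  directed F -> (forall D, F D -> D !=set0) -> F !=set0 ->
  exists a, forall D, F D -> D a.
move: I b F; apply: (fin_type_ind (P := P)) X
    => [{}X Y f [g fK gK] IH||{}X IH] I b F sI defF dirF neF [D0 FD0].
- pose pull (D : set (Y -> C)) : set (X -> C) := [set a : X -> C | D (a \o g)].
  have [|_ _ [D1 FD1 <-] [D2 FD2 <-]|_ [D FD <-]||a Fa] := IH I b (pull @` F) sI.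
  - move=> _ [D FD <-]; have [R [dR DR]] := defF D FD.
    exists (fun w => R (w \o (fun z => match z with inl x => inl (g x)
      | inr y => inr y end))).
    split=> [|a]; first exact: defrel_sub.
    rewrite /pull /= DR; suff -> : sumf (a \o g) b = sumf a b \o (fun z => match z
      with inl x => inl (g x) | inr y => inr y end) by [].
    exact: funext_sum.
  - have [D FD Dsub] := dirF _ _ FD1 FD2.
    by exists (pull D); [exists D|move=> a /Dsub].
  - have [a Da] := neF _ FD; exists (a \o f); rewrite /pull /=.
    by suff -> : (a \o f) \o g = a by []; apply/funext => y /=; rewrite gK.
  - by exists (pull D0), D0.
  by exists (a \o g) => D FD; apply: (Fa (pull D)); exists D.
- exists (fun y : void => match y with end) => D FD.
  have [a Da] := neF _ FD; suff -> : (fun y : void => match y with end) = a by [].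
  by apply/funext => -[].
- pose pr (D : set (option X -> C)) : set C := [set x | exists a : X -> C, D (oapp a x)].
  have [|_ _ [D1 FD1 <-] [D2 FD2 <-]|_ [D FD <-]||c Fc] :=
    @saturated1 I b (pr @` F) sI.
  - move=> _ [D FD <-]; have [R [dR DR]] := defF D FD.
    pose u1 (z : option X + I) : option I + X := match z with
      | inl None => inl None | inl (Some y) => inr y | inr i => inl (Some i) end.
    exists (fun v => exists a, R (sumf v a \o u1)).
    split=> [|x]; first exact: defrel_ex (defrel_sub u1 dR).
    suff eqR a : sumf (oapp b x) a \o u1 = sumf (oapp a x) b.
      split=> [[a Da]|[a Ra]]; exists a; first by rewrite eqR; apply/DR.
      by apply/DR; rewrite -eqR.
    by apply: funext_sum => // -[].
  - have [D FD Dsub] := dirF _ _ FD1 FD2.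
    by exists (pr D); [exists D|move=> x [a /Dsub[D1a D2a]]; split; exists a].
  - have [a Da] := neF _ FD; exists (a None), (a \o some).
    by move: Da; congr (D _); apply: funext_option.
  - by exists (pr D0), D0.
  pose sec (D : set (option X -> C)) : set (X -> C) := [set a : X -> C | D (oapp a c)].
  have [|_ [D FD <-]|_ _ [D1 FD1 <-] [D2 FD2 <-]|_ [D FD <-]||a Fa] :=
    IH (option I) (oapp b c) (sec @` F).
  - exact: small_option.
  - have [R [dR DR]] := defF D FD.
    pose u2 (z : option X + I) : X + option I := match z with
      | inl None => inr None | inl (Some y) => inl y | inr i => inr (Some i) end.
    exists (fun v => R (v \o u2)); split=> [|a]; first exact: defrel_sub.
    rewrite /sec /= DR; suff -> : sumf (oapp a c) b = sumf a (oapp b c) \o u2 by [].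
    by apply: funext_sum => // -[].
  - have [D FD Dsub] := dirF _ _ FD1 FD2.
    by exists (sec D); [exists D|move=> a /Dsub].
  - by have [|a Da] := Fc (pr D); [exists D | exists a].
  - by exists (sec D0), D0.
  by exists (oapp a c) => D FD; apply: (Fa (sec D)); exists D.
Qed.

(** Two finite tuples of the same type are conjugate under an automorphism. *)
Lemma homogeneous_tuple (X : finType) (a d : X -> C) :
  strongly_homogeneous K C ->
  (forall phi : formula L X, sat phi a -> sat phi d) ->
  exists2 s, automorphism s & s \o a = d.
Proof.
move=> homC ad.
have {}ad (phi : formula L X) : sat phi a <-> sat phi d.
  split; first exact: ad.
  move=> dphi; apply: contrapT => naphi; have [psi hpsi] :
    defrel (fun v : X -> C => ~ sat phi v) by apply: defrel_not; exists phi.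
  by have /hpsi := ad psi (proj2 (hpsi a) naphi).
have /choice[f fP] y : exists z, forall x, a x = y -> d x = z.
  have [[x ax]|nx] := pselect (exists x, a x = y); last first.
    by exists y => x ax; case: nx; exists x.
  exists (d x) => x' ax'; suff : sat (FEq (TVar L x') (TVar L x)) d by [].
  by apply/ad; rewrite /= ax ax'.
have faE x : f (a x) = d x by apply/esym/fP.
have /choice[g gP] (y : range a) : exists x, a x = val y.
  by have [x _ <-] := set_mem (valP y); exists x.
have [||s autos sf] := homC (range a) f.
- apply: card_le_lt (small_count smallN X); exact: card_image_le.
- move=> phi; have /= := ad (ren phi g); rewrite !sat_ren.
  have -> : a \o g = (fun y : range a => val y) by apply/funext.
  have -> // : d \o g = (fun y : range a => f (val y)).
  by apply/funext => y; rewrite -gP faE.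
exists s => //; apply/funext => x; rewrite /= sf ?faE //.
by apply/mem_set; exists x.
Qed.

End Saturation.

(** * Definable groups *)

Section Subgroup.
Variables (G : groupType) (H : set G).
Hypothesis subH : subgroup H.

Lemma subgroup1 : H 1%g.
Proof. by case: subH => /set_mem. Qed.

Lemma subgroupM x y : H x -> H y -> H (x * y)%g.
Proof.
by move=> Hx Hy; apply: set_mem; apply: group_closedM => //; apply: mem_set.
Qed.

Lemma subgroupV x : H x -> H x^-1%g.
Proof. by move=> Hx; apply/set_mem/group_closedV => //; apply: mem_set. Qed.

End Subgroup.

Lemma subgroupI (G : groupType) (H : set G) : H 1%g ->
  (forall x y, H x -> H y -> H (x * y)%g) -> (forall x, H x -> H x^-1%g) ->
  subgroup H.
Proof.
move=> H1 HM HV; split; first exact: mem_set.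
by move=> x y /set_mem Hx /set_mem Hy; apply: mem_set; apply: HM => //; apply: HV.
Qed.

Section BoundedIndex.
Variables (K : Type) (G : groupType) (H : set G).
Hypothesis subH : subgroup H.

(** A subgroup has bounded index exactly when its cosets are separated by a map
    into a small type. *)
Lemma bounded_index_small (T : Type) (f : G -> T) :
  small K T -> (forall x y, f x = f y -> H (x^-1 * y)%g) -> bounded_index K H.
Proof.
move=> sT fH; apply: card_le_lt sT.
have /choice[r rP] (Q : left_cosets H) : exists x, [set (x * y)%g | y in H] = val Q.
  by have [x _ <-] := set_mem (valP Q); exists x.
rewrite -(card_le_eql (card_setT (left_cosets H))).
apply: (inj_card_leT (f := fun Q => f (r Q))) => Q1 Q2 /fH Hr.
apply: val_inj; rewrite -!rP; apply/seteqP; split=> _ [y Hy <-].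
  exists ((r Q2)^-1 * (r Q1) * y)%g; last by rewrite -mulgA mulVKg.
  apply: subgroupM => //; rewrite -[X in H X]invgK invgM invgK.
  exact: subgroupV.
exists ((r Q1)^-1 * (r Q2) * y)%g; last by rewrite -mulgA mulVKg.
exact: subgroupM.
Qed.

Lemma bounded_index_inv : bounded_index K H ->
  exists (T : Type) (f : G -> T), small K T /\
    forall x y, f x = f y -> H (x^-1 * y)%g.
Proof.
move=> bdH; exists (left_cosets H).
exists (fun x => SigSub (mem_set (imageT (fun x => [set (x * y)%g | y in H]) x))).
split; first by apply: card_le_lt bdH; rewrite (card_le_eql (card_setT _)).
move=> x y [] /seteqP[_ /(_ y)]; case.
  by exists 1%g; [exact: subgroup1 | exact: mulg1].
by move=> z Hz <-; rewrite mulKg.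
Qed.

End BoundedIndex.

Lemma bounded_index_sub (K : Type) (G : groupType) (H H' : set G) :
  subgroup H -> subgroup H' -> H `<=` H' -> bounded_index K H -> bounded_index K H'.
Proof.
move=> sH sH' HH' /(bounded_index_inv sH)[T [f [sT fH]]].
by apply: (bounded_index_small sH' sT (f := f)) => x y /fH /HH'.
Qed.

Lemma type_definable_invariant (L : language) (C : structure L) (V : Type)
  (S : set (V -> C)) : type_definable S -> aut_invariant S.
Proof.
by move=> [Phi ->] s auts a Sa phi Phi_phi; apply/(sat_automorphism auts)/Sa.
Qed.

Section DefinableGroup.
Variables (K : Type) (L : language) (C : structure L).
Hypothesis smallN : small K nat.
Hypothesis satC : saturated K C.
Hypothesis homC : strongly_homogeneous K C.
Variables (G : groupType) (X : finType) (c : G -> X -> C).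
Hypothesis defG : definable_group c.

Let c_inj : injective c. Proof. by case: defG. Qed.

Let range_c : defrel (range c).
Proof. by case: defG => _ /definableP. Qed.

(** The concatenation of the coordinates of a family of elements of [G]. *)
Definition coords (V : Type) (g : V -> G) (z : V * X) : C := c (g z.1) z.2.

(** Relations between elements of [G] that are definable without parameters in
    terms of their coordinates.  Nothing is asked of [S] outside the coordinates of
    elements of [G], so that [V] may be infinite. *)
Definition gdef (V : Type) (R : (V -> G) -> Prop) : Prop :=
  exists S : (V * X -> C) -> Prop, defrel S /\ forall g, S (coords g) <-> R g.

(** Definable subsets of [G]. *)
Definition dset (D : set G) : Prop := definable (c @` D).

Lemma gdef_ext V (R R' : (V -> G) -> Prop) :
  (forall g, R g <-> R' g) -> gdef R -> gdef R'.
Proof. by move=> RR' [S [dS SR]]; exists S; split=> // g; rewrite SR RR'. Qed.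

Lemma gdef_and V (R R' : (V -> G) -> Prop) :
  gdef R -> gdef R' -> gdef (fun g => R g /\ R' g).
Proof.
move=> [S [dS SR]] [S' [dS' SR']]; exists (fun v => S v /\ S' v).
by split=> [|g]; [exact: defrel_and | rewrite SR SR'].
Qed.

Lemma gdef_not V (R : (V -> G) -> Prop) : gdef R -> gdef (fun g => ~ R g).
Proof.
move=> [S [dS SR]]; exists (fun v => ~ S v).
by split=> [|g]; [exact: defrel_not | rewrite SR].
Qed.

Lemma gdef_true V : gdef (fun _ : V -> G => True).
Proof. by exists (fun=> True); split=> //; exact: defrel_true. Qed.

Lemma gdef_imp V (R R' : (V -> G) -> Prop) :
  gdef R -> gdef R' -> gdef (fun g => R g -> R' g).
Proof.
move=> [S [dS SR]] [S' [dS' SR']]; exists (fun v => S v -> S' v).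
by split=> [|g]; [exact: defrel_imp | rewrite SR SR'].
Qed.

Lemma gdef_or V (R R' : (V -> G) -> Prop) :
  gdef R -> gdef R' -> gdef (fun g => R g \/ R' g).
Proof.
move=> dR dR'; apply: gdef_ext (gdef_imp (gdef_not dR) dR') => g.
split=> [h|[Rg /(_ Rg)|R'g _] //].
by have [Rg|/h R'g] := pselect (R g); [left | right].
Qed.

Lemma gdef_sub V W (u : V -> W) (R : (V -> G) -> Prop) :
  gdef R -> gdef (fun g : W -> G => R (g \o u)).
Proof.
move=> [S [dS SR]]; exists (fun w => S (w \o (fun z => (u z.1, z.2)))).
by split=> [|g]; [exact: defrel_sub | rewrite -SR].
Qed.

Lemma gdef_ex V (R : (option V -> G) -> Prop) :
  gdef R -> gdef (fun g => exists x, R (oapp g x)).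
Proof.
move=> [S [dS SR]].
pose u (z : option V * X) : V * X + X :=
  match z with (Some v, x) => inl (v, x) | (None, x) => inr x end.
exists (fun v => exists a : X -> C, range c (sumf v a \o inr) /\
  S (sumf v a \o u)).
split=> [|g].
  apply: (defrel_ex (R := fun w => range c (w \o inr) /\ S (w \o u))).
  by apply: defrel_and; apply: defrel_sub.
have gu x : sumf (coords g) (c x) \o u = coords (oapp g x).
  by apply/funext => -[[v|] y].
split=> [[a [[x _ xa] Sa]]|[x Rx]].
  by exists x; apply/SR; move: Sa; rewrite -gu xa.
by exists (c x); split; [exists x | rewrite gu SR].
Qed.

Lemma gdef_in V (v : V) D : dset D -> gdef (fun g => D (g v)).
Proof.
move=> /definableP dD; exists (fun w => (c @` D) (w \o (fun x => (v, x)))).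
split=> [|g]; first exact: defrel_sub.
split=> [[x Dx e]|Dgv]; last by exists (g v).
by rewrite -(c_inj (e : c x = c (g v))).
Qed.

Lemma dsetP D : gdef (fun g : unit -> G => D (g tt)) -> dset D.
Proof.
move=> [S [dS SD]]; apply/definableP.
apply: defrel_ext (defrel_and range_c (defrel_sub snd dS)) => a.
split=> [[[x _ <-] Sx]|[x Dx <-]].
  by exists x => //; apply: (proj1 (SD (fun=> x))).
by split; [exists x | apply: (proj2 (SD (fun=> x)))].
Qed.

Lemma gdef_eq V (v w : V) : gdef (fun g => g v = g w).
Proof.
suff dd : gdef (fun g : bool -> G => g true = g false).
  by apply: gdef_ext (gdef_sub (fun b : bool => if b then v else w) dd).
exists (fun a => forall x, a (true, x) = a (false, x)); split=> [|g]; last first.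
  by split=> [h|e x]; [apply/c_inj/funext => x; apply: h | rewrite /coords /= e].
have h (s : seq X) : defrel (fun a : bool * X -> C =>
    forall x, x \in s -> a (true, x) = a (false, x)).
  elim: s => [|x s IH].
    by apply: defrel_ext (defrel_true _ _) => a; split.
  apply: defrel_ext (defrel_and (defrel_eq C (true, x) (false, x)) IH) => a.
  split=> [[e h] y|h]; first by rewrite inE => /orP[/eqP -> //|]; apply: h.
  by split=> [|y ys]; apply: h; rewrite inE ?eqxx ?ys ?orbT.
apply: defrel_ext (h (enum X)) => a.
by split=> e x; [apply: e; rewrite mem_enum | move=> _; exact: e].
Qed.

Lemma gdef_mul V (u v w : V) : gdef (fun g => (g u * g v)%g = g w).
Proof.
case: defG => _ _ /definableP dm.
pose r (z : (X + X) + X) : V * X := match z with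
  | inl (inl x) => (u, x) | inl (inr x) => (v, x) | inr x => (w, x) end.
exists (fun a => range (fun p : G * G =>
  coord_pair (coord_pair c c) c (p, p.1 * p.2)%g) (a \o r)).
split=> [|g]; first exact: defrel_sub.
have rE : coords g \o r = coord_pair (coord_pair c c) c ((g u, g v), g w).
  by apply/funext => -[[x|x]|x].
rewrite rE; split=> [[[x y] _ /= e]|e]; last by exists (g u, g v); rewrite //= e.
have ex : x = g u by apply/c_inj/funext => t; have := congr1 (@^~ (inl (inl t))) e.
have ey : y = g v by apply/c_inj/funext => t; have := congr1 (@^~ (inl (inr t))) e.
by rewrite -ex -ey; apply/c_inj/funext => t; have := congr1 (@^~ (inr t)) e.
Qed.

Lemma gdef_in_divl V (u v : V) D : dset D -> gdef (fun g => D ((g u)^-1 * g v)%g).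
Proof.
move=> dD; apply: gdef_ext (gdef_ex (gdef_and
  (gdef_mul (Some u) None (Some v)) (gdef_in None dD))) => g /=.
split=> [[x [<-]]|Dm]; first by rewrite mulKg.
by exists ((g u)^-1 * g v)%g; rewrite mulVKg.
Qed.

Lemma dset_setI D1 D2 : dset D1 -> dset D2 -> dset (D1 `&` D2).
Proof. by move=> d1 d2; apply: dsetP; apply: gdef_and; apply: gdef_in. Qed.

Lemma dset_setU D1 D2 : dset D1 -> dset D2 -> dset (D1 `|` D2).
Proof. by move=> d1 d2; apply: dsetP; apply: gdef_or; apply: gdef_in. Qed.

Lemma dset_setC D : dset D -> dset (~` D).
Proof. by move=> dD; apply: dsetP; apply: gdef_not; apply: gdef_in. Qed.

Lemma dset_setT : dset setT.
Proof. by apply: dsetP; apply: gdef_true. Qed.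

Lemma dset_set1 : dset [set 1%g].
Proof.
apply: dsetP; apply: gdef_ext (gdef_mul tt tt tt) => g /=.
split=> [e|->]; last by rewrite mulg1.
by apply: (mulgI (g tt)); rewrite mulg1.
Qed.

Lemma dset_inv D : dset D -> dset [set x | D x^-1%g].
Proof.
move=> dD; apply: dsetP.
apply: gdef_ext (gdef_ex (gdef_and (gdef_in None dset_set1)
  (gdef_in_divl (Some tt) None dD))) => g /=.
by split=> [[_ [->]]|Dm]; [rewrite mulg1 | exists 1%g; rewrite mulg1].
Qed.

Lemma dset_prod D1 D2 : dset D1 -> dset D2 ->
  dset [set u | exists x y, [/\ D1 x, D2 y & u = (x * y)%g]].
Proof.
move=> d1 d2; apply: dsetP.
apply: gdef_ext (gdef_ex (gdef_and (gdef_in None d1)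
  (gdef_in_divl None (Some tt) d2))) => g /=.
split=> [[x [D1x D2x]]|[x [y [D1x D2y ->]]]].
  by exists x, (x^-1 * g tt)%g; rewrite mulVKg.
by exists x; rewrite mulKg.
Qed.

(** Saturation for subsets of [G] defined with a small set of parameters. *)
Lemma gsat (I : Type) (b : I -> G) (F : set (set G)) :
  small K I ->
  (forall D, F D -> exists R, gdef R /\ forall x, D x <-> R (oapp b x)) ->
  directed F -> (forall D, F D -> D !=set0) -> F !=set0 ->
  exists x, forall D, F D -> D x.
Proof.
move=> sI defF dirF neF [D0 FD0].
pose img (D : set G) := c @` D.
have [||_ _ [D1 FD1 <-] [D2 FD2 <-]|_ [D FD <-]||a Fa] :=
  @saturated_fin _ _ _ smallN satC X (I * X)%type (coords b) (img @` F).
- exact: small_prod_count.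
- move=> _ [D FD <-]; have [R [[S [dS SR]] DR]] := defF D FD.
  pose u (z : option I * X) : X + I * X :=
    match z with (Some v, x) => inr (v, x) | (None, x) => inl x end.
  exists (fun w => range c (w \o inl) /\ S (w \o u)); split=> [|a].
    by apply: defrel_and; apply: defrel_sub.
  have uE x : sumf (c x) (coords b) \o u = coords (oapp b x).
    by apply/funext => -[[v|] y].
  split=> [[x Dx <-]|[[x _ xa] Sa]]; first by split; [exists x | rewrite uE SR -DR].
  have {}xa : c x = a by [].
  by exists x => //; rewrite DR -SR -uE xa.
- have [D FD Dsub] := dirF _ _ FD1 FD2.
  by exists (img D); [exists D | move=> _ [x /Dsub[? ?] <-]; split; exists x].
- by have [x Dx] := neF _ FD; exists (c x), x.
- by exists (img D0), D0.
have [|x _ xa] := Fa (img D0); first by exists D0.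
exists x => D FD; have [|y Dy] := Fa (img D); first by exists D.
by rewrite -xa => /c_inj <-.
Qed.

(** ** Type-definable subsets *)

(** Subsets of [G] that are type-definable without parameters. *)
Definition tdset (F : set G) : Prop := type_definable (c @` F).

(** A set is type-definable if and only if it is the intersection of its definable
    supersets. *)
Lemma tdsetP F :
  tdset F <-> forall x, (forall D, dset D -> F `<=` D -> D x) -> F x.
Proof.
split=> [[Phi eF] x Dx|h].
  suff : (c @` F) (c x) by move=> [y Fy /c_inj <-].
  rewrite eF => phi Pphi; apply: (Dx [set y | sat phi (c y)]).
    apply: dsetP; exists (fun w => sat phi (w \o pair tt)); split=> [|g] //.
    by apply: defrel_sub; exists phi.
  move=> y Fy; have : (c @` F) (c y) by exists y.
  by rewrite eF; apply.
exists [set phi | forall y, F y -> sat phi (c y)].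
apply/seteqP; split=> [_ [y Fy <-] phi|a ha]; first exact.
have [phi phiP] := range_c.
have [x _ xa] : range c a by apply/phiP/ha => y _; apply/phiP; exists y.
exists x => //; apply: h => D /definableP[psi psiP] FD.
have : (c @` D) a by apply/psiP/ha => y Fy; apply/psiP; exists y => //; apply: FD.
by rewrite -xa => -[y Dy /c_inj <-].
Qed.

Lemma tdset_bigcap (FF : set (set G)) :
  (forall D, FF D -> tdset D) -> tdset (\bigcap_(D in FF) D).
Proof.
move=> tF; apply/tdsetP => x hx D FD; apply: (proj1 (tdsetP D) (tF D FD)) => E dE DE.
by apply: hx => // y Fy; apply: DE; apply: Fy.
Qed.

Lemma dset_tdset D : dset D -> tdset D.
Proof. by move=> dD; apply/tdsetP => x h; apply: h. Qed.

(** The product of the intersections of two directed families of definable sets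
    is the intersection of the products. *)
Lemma prod_compact (FF1 FF2 : set (set G)) u :
  (forall D, FF1 D -> dset D) -> (forall D, FF2 D -> dset D) ->
  (forall D1 D2, FF1 D1 -> FF1 D2 -> FF1 (D1 `&` D2)) ->
  (forall D1 D2, FF2 D1 -> FF2 D2 -> FF2 (D1 `&` D2)) ->
  FF1 !=set0 -> FF2 !=set0 ->
  (forall D1 D2, FF1 D1 -> FF2 D2 -> exists x, D1 x /\ D2 (x^-1 * u)%g) ->
  exists x, (forall D, FF1 D -> D x) /\ (forall D, FF2 D -> D (x^-1 * u)%g).
Proof.
move=> d1 d2 i1 i2 [E1 F1] [E2 F2] hu.
pose m (D1 D2 : set G) : set G := [set x | D1 x /\ D2 (x^-1 * u)%g].
pose F D := exists D1 D2, [/\ FF1 D1, FF2 D2 & D = m D1 D2].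
have [|||||x Fx] := @gsat unit (fun=> u) F.
- exact: small_count.
- move=> _ [D1 [D2 [FD1 FD2 ->]]].
  exists (fun g => D1 (g None) /\ D2 ((g None)^-1 * g (Some tt))%g).
  by split=> //; apply: gdef_and; [apply/gdef_in/d1 | apply/gdef_in_divl/d2].
- move=> _ _ [D1 [D2 [FD1 FD2 ->]]] [D1' [D2' [FD1' FD2' ->]]].
  exists (m (D1 `&` D1') (D2 `&` D2')); last by move=> x [[? ?] [? ?]]; split.
  by exists (D1 `&` D1'), (D2 `&` D2'); split=> //; [exact: i1 | exact: i2].
- by move=> _ [D1 [D2 [FD1 FD2 ->]]]; apply: hu.
- by exists (m E1 E2), E1, E2.
exists x; split=> D FD.
  by have [] : m D E2 x by apply: Fx; exists D, E2.
by have [] : m E1 D x by apply: Fx; exists E1, D.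
Qed.

(** The set of the products [x * y] with [x] in [F1] and [y] in [F2]. *)
Definition setprod (F1 F2 : set G) : set G :=
  [set u | exists x y, [/\ F1 x, F2 y & u = (x * y)%g]].

Lemma tdset_prod F1 F2 : tdset F1 -> tdset F2 -> tdset (setprod F1 F2).
Proof.
move=> /tdsetP t1 /tdsetP t2; apply/tdsetP => u hu.
pose FF (F : set G) : set (set G) := [set D | dset D /\ F `<=` D].
have FFi F D1 D2 : FF F D1 -> FF F D2 -> FF F (D1 `&` D2).
  move=> [d1 s1] [d2 s2]; split; first exact: dset_setI.
  by move=> x Fx; split; [exact: s1 | exact: s2].
have FFT F : FF F !=set0 by exists setT; split=> //; exact: dset_setT.
have [D []//|D []//||||||x [x1 x2]] := @prod_compact (FF F1) (FF F2) u; try exact: FFi.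
- exact: FFT.
- exact: FFT.
- move=> D1 D2 [d1 s1] [d2 s2].
  have [|x [y [D1x D2y ->]]] := hu _ (dset_prod d1 d2).
    by move=> _ [x [y [/s1 D1x /s2 D2y ->]]]; exists x, y.
  by exists x; rewrite mulKg.
exists x, (x^-1 * u)%g; rewrite mulVKg; split=> //.
  by apply: t1 => D dD sD; apply: x1.
by apply: t2 => D dD sD; apply: x2.
Qed.

(** An invariant set is a union of sets of realizations of types. *)
Lemma invariant_type (H : set G) x y : aut_invariant (c @` H) -> H x ->
  (forall D, dset D -> D x -> D y) -> H y.
Proof.
move=> invH Hx xy.
have [|s auts sx] := @homogeneous_tuple _ _ _ smallN X (c x) (c y) homC.
  move=> phi; apply: (xy [set z | sat phi (c z)]).
  apply: dsetP; exists (fun w => sat phi (w \o pair tt)); split=> [|g] //.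
  by apply: defrel_sub; exists phi.
have [|z Hz] := invH s auts (c x); first by exists x.
by rewrite sx => /c_inj <-.
Qed.

End DefinableGroup.

(** * Counting formulas *)

Section Counting.
Variable L : language.

Lemma ren_termK V W (u : V -> W) (w : W -> V) (t : term L V) :
  cancel u w -> ren_term w (ren_term u t) = t.
Proof.
by move=> uK; elim: t => [x|f a IH] /=; [rewrite uK | congr TApp; apply/funext].
Qed.

Lemma renK V W (u : V -> W) (w : W -> V) (p : formula L V) :
  cancel u w -> ren (ren p u) w = p.
Proof.
elim: p W u w => [{}V|{}V s t|{}V r a|{}V p IHp q IHq|{}V p IHp] W u w uK //=.
- by rewrite !ren_termK.
- by congr FRel; apply/funext => i; rewrite ren_termK.
- by rewrite IHp // IHq.
- by rewrite IHp // => -[x|] //=; rewrite uK.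
Qed.

(** Quantifying universally over all variables is syntactically injective. *)
Lemma formula_inj_sentence (X : finType) :
  exists j : formula L X -> formula L void, injective j.
Proof.
apply: (fin_type_ind (P := fun X => exists j : formula L X -> formula L void,
  injective j)) X => [V W f [g fK gK] [j jinj]||X [j jinj]].
- exists (fun p => j (ren p g)) => p q /jinj e.
  by rewrite -(renK p gK) e renK.
- by exists id.
- by exists (fun p => j (FAll p)) => p q /jinj [].
Qed.

Lemma nat_inj_sentence : exists num : nat -> formula L void, injective num.
Proof.
exists (fun n => iter n (FImp (FBot L void)) (FBot L void)).
by elim=> [|n IH] [|m] //= [/IH ->].
Qed.

Lemma small_nat (K : Type) : small K (set (formula L void)) -> small K nat.
Proof.
have [num num_inj] := nat_inj_sentence.
apply: (small_inj (f := fun n => [set num n])) => n m e.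
by apply: num_inj; have : [set num m] (num n) by rewrite -e.
Qed.

Lemma small_set_formula (K : Type) (X : finType) :
  small K (set (formula L void)) -> small K (set (formula L X * nat)).
Proof.
have [j jinj] := formula_inj_sentence X.
have [num num_inj] := nat_inj_sentence.
pose k (p : formula L X * nat) := FImp (num p.2) (j p.1).
have kinj : injective k by move=> [p n] [q m] [/num_inj -> /jinj ->].
have ksub S T : k @` S = k @` T -> S `<=` T.
  move=> e x Sx; have : (k @` S) (k x) by exists x.
  by rewrite e => -[y Ty /kinj <-].
apply: (small_inj (f := fun S => k @` S)) => S T e.
by apply/seteqP; split; apply: ksub.
Qed.

End Counting.

(** * Thick sets and the component they generate *)

Section Clique.
Variable G : groupType.
Implicit Types (U : set G) (s : seq G).

(** Distinct elements of [s] have their quotients in [U]. *)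
Definition clique U s : Prop :=
  forall x y, x \in s -> y \in s -> x <> y -> U (x^-1 * y)%g.

(** [s] extends to a clique by [n] new elements. *)
Fixpoint ext_clique U (n : nat) s : Prop :=
  if n is n'.+1 then exists y, ~ (y \in s) /\ ext_clique U n' (y :: s)
  else clique U s.

Lemma ext_clique_mono U U' n s s' : U `<=` U' -> {subset s' <= s} ->
  ext_clique U n s -> ext_clique U' n s'.
Proof.
move=> UU'; elim: n s s' => [|n IH] s s' ss' /=.
  by move=> h x y xs ys xy; apply/UU'/h => //; apply: ss'.
move=> [y [ys ey]]; exists y; split; first by move=> /ss'.
apply: IH ey => x; rewrite !inE => /orP[->//|/ss' ->]; exact: orbT.
Qed.

Lemma ext_clique_le U m n s : m <= n -> ext_clique U n s -> ext_clique U m s.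
Proof.
elim: n s => [|n IH] s; first by rewrite leqn0 => /eqP ->.
rewrite leq_eqVlt => /orP[/eqP -> //|]; rewrite ltnS => mn [y [_ /(IH _ mn)]].
by apply: ext_clique_mono => // x xs; rewrite inE xs orbT.
Qed.

Lemma ext_cliqueP U n : ext_clique U n [::] <->
  exists s, [/\ uniq s, size s = n & clique U s].
Proof.
suff h s : uniq s -> ext_clique U n s <->
    exists t, [/\ uniq (t ++ s), size t = n & clique U (t ++ s)].
  rewrite h //; split=> -[t]; rewrite ?cats0 => ht; exists t; by rewrite ?cats0.
elim: n s => [|n IH] s us /=.
  split=> [cs|[t [_ /size0nil ->]]] //; by exists [::].
split=> [[y [/negP ys]]|[t]].
  move=> /IH[|t [ut st ct]]; first by rewrite /= ys.
  by exists (rcons t y); rewrite cat_rcons size_rcons st.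
case/lastP: t => [[]|t y] //; rewrite cat_rcons size_rcons => -[ut [st] ct].
have uys : uniq (y :: s) by move: ut; rewrite cat_uniq => /and3P[].
exists y; split; first by apply/negP; case/andP: uys.
by apply/IH => //; exists t.
Qed.

Lemma maximal_clique U n s : clique U s -> ~ ext_clique U n s ->
  exists2 t, clique U t & forall x, ~ (x \in t) -> ~ clique U (x :: t).
Proof.
elim: n s => [|n IH] s //= cs next.
have [[y [ys cy]]|nx] := pselect (exists y, ~ (y \in s) /\ clique U (y :: s)).
  by apply: (IH (y :: s)) => // ey; apply: next; exists y.
by exists s => // x xs cx; apply: nx; exists x.
Qed.

End Clique.

Section Core.
Variables (K : Type) (L : language) (C : structure L).
Hypothesis smallN : small K nat.
Hypothesis small_theory : small K (set (formula L void)).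
Hypothesis satC : saturated K C.
Hypothesis homC : strongly_homogeneous K C.
Variables (G : groupType) (X : finType) (c : G -> X -> C).
Hypothesis defG : definable_group c.

Lemma gdef_all (V : Type) (T : eqType) (l : seq T) (R : T -> (V -> G) -> Prop) :
  (forall t, gdef c (R t)) -> gdef c (fun g => forall t, t \in l -> R t g).
Proof.
move=> dR; elim: l => [|t l IH].
  by apply: gdef_ext (gdef_true _ _) => g; split.
apply: gdef_ext (gdef_and (dR t) IH) => g; split=> [[Rt Rl] t'|h].
  by rewrite inE => /orP[/eqP -> //|]; exact: Rl.
by split=> [|t' t'l]; apply: h; rewrite inE ?eqxx ?t'l ?orbT.
Qed.

Lemma notin_map (V : eqType) (g : V -> G) (l : seq V) x :
  ~ (x \in map g l) <-> forall v, v \in l -> x <> g v.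
Proof.
split=> [h v vl e|h /mapP[v vl]]; last exact: h.
by apply: h; apply/mapP; exists v.
Qed.

Lemma gdef_notin (V : eqType) (v : V) (l : seq V) :
  gdef c (fun g => ~ (g v \in map g l)).
Proof.
have := @gdef_all V V l (fun w g => g v <> g w) (fun w =>
  gdef_not (gdef_eq defG v w)).
by apply: gdef_ext => g; rewrite notin_map.
Qed.

Lemma gdef_ext_clique U n (V : eqType) (l : seq V) :
  dset c U -> gdef c (fun g => ext_clique U n (map g l)).
Proof.
move=> dU; elim: n V l => [|n IH] V l /=.
  have := @gdef_all V V l (fun v g => forall w, w \in l -> g v <> g w ->
    U ((g v)^-1 * g w)%g) (fun v => gdef_all l (fun w => gdef_imp
      (gdef_not (gdef_eq defG v w)) (gdef_in_divl defG v w dU))).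
  apply: gdef_ext => g; split=> [h x y /mapP[v vl ->] /mapP[w wl ->]|h v vl w wl].
    exact: h.
  by apply: h; apply: map_f.
apply: gdef_ext (gdef_ex defG (gdef_and (gdef_notin None (map some l))
  (IH _ (None :: map some l)))) => g.
by split=> -[y h]; exists y; rewrite /= -map_comp in h *.
Qed.

(** A thick set is a symmetric definable set containing 1 such that the size of the
    finite subsets of [G] whose distinct elements have all their quotients outside
    of it is bounded. *)
Definition thick (D : set G) : Prop :=
  [/\ dset c D, D 1%g, forall x, D x -> D x^-1%g
    & exists n, ~ ext_clique (~` D) n [::]].

Lemma thickT : thick setT.
Proof.
split=> //; first exact: dset_setT.
exists 2 => -[x [_ [y [yx /(_ y x) h]]]].
have nyx : y <> x by move=> e; apply: yx; rewrite e mem_head.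
by case: h => //; rewrite !inE eqxx ?orbT.
Qed.

Lemma thickI D1 D2 : thick D1 -> thick D2 -> thick (D1 `&` D2).
Proof.
move=> [d1 o1 s1 [m1 h1]] [d2 o2 s2 [m2 h2]]; split=> //.
- exact: dset_setI.
- by move=> x [/s1 ? /s2 ?].
pose R D (x y : G) := ~ D (x^-1 * y)%g.
have symR D : (forall x, D x -> D x^-1%g) -> forall x y, R D x y -> R D y x.
  by move=> sD x y Rxy /sD; rewrite invgM invgK.
have [n hn] := ramsey (symR _ s1) (symR _ s2) m1 m2.
exists n => /ext_cliqueP[s [us ss cs]].
have [||[t [ut st _ ct]]|[t [ut st _ ct]]] := hn s us.
- by rewrite ss.
- by move=> x y xs ys xy; apply/not_andP; apply: (cs x y).
- by apply: h1; apply/ext_cliqueP; exists t.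
- by apply: h2; apply/ext_cliqueP; exists t.
Qed.

(** The elements of a maximal clique of the complement of [D] give finitely many
    translates of [D] covering [G]. *)
Lemma thick_cover D : thick D ->
  exists s : seq G, forall x, exists2 a, a \in s & D (a^-1 * x)%g.
Proof.
move=> [_ D1 Dsym [n hn]].
have [//|s cs smax] := maximal_clique _ hn.
exists s => x; have [xs|/smax ncx] := pselect (x \in s).
  by exists x; rewrite ?mulVg.
apply: contrapT => nD; apply: ncx => y z.
have nDx a : a \in s -> ~ D (a^-1 * x)%g by move=> sa Da; apply: nD; exists a.
rewrite !inE => /orP[/eqP ->|ys] /orP[/eqP ->|zs] // yz.
- by move=> /Dsym; rewrite invgM invgK; apply: nDx.
- exact: nDx.
- exact: cs.
Qed.

(** The intersection of the thick sets. *)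
Definition core0 : set G := [set x | forall D, thick D -> D x].

(** The products of [2 ^ n] elements of [core0]. *)
Fixpoint core (n : nat) : set G :=
  if n is n'.+1 then setprod (core n') (core n') else core0.

(** The subgroup generated by the intersection of the thick sets. *)
Definition core_group : set G := [set x | exists n, core n x].

Lemma core_tdset n : tdset c (core n).
Proof.
elim: n => [|n IH] /=; last exact: (tdset_prod smallN satC defG).
apply/(tdsetP defG) => x h D tD; apply: h; first by case: tD.
by move=> y; apply.
Qed.

Lemma core1 n : core n 1%g.
Proof.
by elim: n => [D []//|n IH]; exists 1%g, 1%g; rewrite mulg1; split.
Qed.

Lemma coreV n x : core n x -> core n x^-1%g.
Proof.
elim: n x => [|n IH] x; first by move=> h D tD; case: (tD) => _ _ + _; apply; exact: h.
by move=> [y [z [/IH hy /IH hz ->]]]; exists z^-1%g, y^-1%g; rewrite invgM.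
Qed.

Lemma core_le m n : m <= n -> core m `<=` core n.
Proof.
elim: n => [|n IH]; first by rewrite leqn0 => /eqP ->.
rewrite leq_eqVlt => /orP[/eqP -> //|]; rewrite ltnS => /IH mn x /mn cx.
by exists x, 1%g; rewrite mulg1; split=> //; exact: core1.
Qed.

Lemma core_group_subgroup : subgroup core_group.
Proof.
apply: subgroupI; first by exists 0; exact: core1.
  move=> x y [m cx] [n cy]; exists (maxn m n).+1, x, y; split=> //.
    exact: core_le (leq_maxl _ _) _ cx.
  exact: core_le (leq_maxr _ _) _ cy.
by move=> x [n /coreV cx]; exists n.
Qed.

Lemma core_group_invariant : aut_invariant (c @` core_group).
Proof.
move=> s auts _ [x [n cx] <-].
have [|y cy <-] := type_definable_invariant (core_tdset n) auts (a := c x).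
  by exists x.
by exists y => //; exists n.
Qed.

(** If [a] in [core0] is outside [H], then for a symmetric definable set [U]
    containing [a], the complement of [U] together with 1 is not thick, that is,
    [U] has arbitrarily large cliques.  A maximal set [Z] that is a clique for every [U], and whose
    finite subsets extend to arbitrarily large cliques, has its elements in distinct
    cosets of [H], so is small; by saturation it is not maximal. *)
Lemma core0_sub (H : set G) : subgroup H -> aut_invariant (c @` H) ->
  bounded_index K H -> core0 `<=` H.
Proof.
move=> subH invH /(bounded_index_inv subH)[T [f [sT fH]]] a core_a.
apply: contrapT => nHa.
pose fam (U : set G) := [/\ dset c U, U a & forall x, U x -> U x^-1%g].
have famI U U' : fam U -> fam U' -> fam (U `&` U').
  move=> [dU Ua sU] [dU' U'a sU']; split=> //; first exact: dset_setI.
  by move=> x [/sU ? /sU' ?].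
pose Q (s : seq G) := forall U n, fam U -> ext_clique U n s.
have Qnil : Q [::].
  move=> U n [dU Ua sU]; apply: contrapT => next.
  have tD : thick (~` U `|` [set 1%g]).
    split; [|by right| |].
    - by apply: dset_setU => //; [exact: dset_setC | exact: dset_set1].
    - by move=> x [nUx|->]; [left=> /sU; rewrite invgK | right; rewrite invg1].
    - exists n; apply: contra_not next; apply: ext_clique_mono => // x.
      by move=> /not_orP[/contrapT].
  case: (core_a _ tD) => // a1; apply: nHa; rewrite a1; exact: subgroup1.
have [Z [goodZ maxZ]] := tukey Qnil.
have ZU x y U : Z x -> Z y -> x <> y -> fam U -> U (x^-1 * y)%g.
  move=> Zx Zy xy fU; apply: (goodZ [:: x; y] _ U 0 fU) => //.
  - by move=> z; rewrite !inE => /orP[] /eqP ->.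
  - by rewrite inE eqxx.
  - by rewrite !inE eqxx orbT.
(* a quotient of two elements of Z has the type of a or of its inverse, up to
   separating it and its inverse from a by one symmetric definable set *)
have ZH x y : Z x -> Z y -> H (x^-1 * y)%g -> x = y.
  move=> Zx Zy Hd; apply: contrapT => xy; set d := (x^-1 * y)%g in Hd.
  have sep e : H e -> exists D, [/\ dset c D, D e & ~ D a].
    move=> He; apply: contrapT => ne; apply: nHa.
    apply: (invariant_type smallN homC defG invH He) => D dD De.
    by apply: contrapT => nDa; apply: ne; exists D.
  have [D1 [d1 D1d nD1a]] := sep _ Hd.
  have [D2 [d2 D2d nD2a]] := sep _ (subgroupV subH Hd).
  pose E := ~` (D1 `|` D2); have dE : dset c E by apply/dset_setC/dset_setU.
  have [||] := ZU x y (E `|` [set z | E z^-1%g]) Zx Zy xy.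
  - split; first by apply: dset_setU => //; exact: dset_inv.
      by left=> -[].
    by move=> z [Ez|Ez]; [right; rewrite /= invgK | left].
  - by move=> h; apply: h; left.
  - by move=> h; apply: h; right.
pose I := {x : G | x \in Z}.
have ZI (i : I) : Z (val i) by apply: set_mem; exact: valP i.
have sI : small K I.
  apply: (small_inj (f := fun i : I => f (val i))) sT => i j /fH Hij.
  by apply: val_inj; apply: ZH.
pose m (s : seq I) U n : set G :=
  [set x | ~ (x \in map val s) /\ ext_clique U n (x :: map val s)].
pose F D := exists s U n, fam U /\ D = m s U n.
have sub1 (s1 s2 : seq I) : {subset map val s1 <= map (val : I -> G) (s1 ++ s2)}.
  by move=> z; rewrite map_cat mem_cat => ->.
have sub2 (s1 s2 : seq I) : {subset map val s2 <= map (val : I -> G) (s1 ++ s2)}.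
  by move=> z; rewrite map_cat mem_cat => ->; rewrite orbT.
have subc (x : G) (s s' : seq G) : {subset s <= s'} -> {subset x :: s <= x :: s'}.
  by move=> ss' z; rewrite !inE => /orP[->//|/ss' ->]; exact: orbT.
have [||||x Fx] := @gsat _ _ _ smallN satC _ _ _ defG I val F sI.
- move=> _ [s [U [n [[dU _ _] ->]]]].
  exists (fun g => ~ (g None \in map g (map some s)) /\
    ext_clique U n (map g (None :: map some s))); split.
    by apply: gdef_and; [exact: gdef_notin | exact: gdef_ext_clique].
  by move=> x; rewrite /= -map_comp.
- move=> _ _ [s1 [U1 [n1 [f1 ->]]]] [s2 [U2 [n2 [f2 ->]]]].
  exists (m (s1 ++ s2) (U1 `&` U2) (maxn n1 n2)).
    by exists (s1 ++ s2), (U1 `&` U2), (maxn n1 n2); split=> //; exact: famI.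
  move=> x [xs ex]; split; split.
  + by move=> /(sub1 s1 s2).
  + apply: ext_clique_mono (ext_clique_le (leq_maxl n1 n2) ex); first by move=> ? [].
    exact: subc.
  + by move=> /(sub2 s1 s2).
  + apply: ext_clique_mono (ext_clique_le (leq_maxr n1 n2) ex); first by move=> ? [].
    exact: subc.
- move=> _ [s [U [n [fU ->]]]].
  have [|x hx] := goodZ (map val s) _ U n.+1 fU; last by exists x.
  by move=> _ /mapP[i _ ->].
- have fT : fam setT by split=> //; exact: dset_setT.
  by exists (m [::] setT 0), [::], setT, 0.
have fT : fam setT by split=> //; exact: dset_setT.
have Zx : Z x.
  apply: maxZ => s sZ U n fU.
  pose s' : seq I := pmap insub [seq z <- s | z != x].
  have [_] : m s' U n x by apply: Fx; exists s', U, n.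
  apply: ext_clique_mono => // z zs; rewrite inE.
  have [//|zx] := eqVneq z x => /=.
  have zZ : z \in Z by apply: mem_set; case: (sZ z zs) => // zx'; rewrite zx' eqxx in zx.
  apply/mapP; exists (Sub z zZ) => //.
  by rewrite mem_pmap_sub mem_filter /= zx zs.
pose i : I := Sub x (mem_set Zx).
have [] : m [:: i] setT 0 x by apply: Fx; exists [:: i], setT, 0.
by move=> h; case: h; rewrite inE.
Qed.

Lemma core_group_sub (H : set G) : subgroup H -> aut_invariant (c @` H) ->
  bounded_index K H -> core_group `<=` H.
Proof.
move=> subH invH bdH x [n].
elim: n x => [|n IH] x; first exact: core0_sub.
by move=> [y [z [/IH Hy /IH Hz ->]]]; exact: subgroupM.
Qed.

(** The index is bounded by the number of sets of pairs made of a formula and of an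
    integer: [f x] records which of the chosen translates of thick sets contain
    [x]. *)
Lemma core_group_bounded : bounded_index K core_group.
Proof.
pose ev (phi : formula L X) : set G := [set x | sat phi (c x)].
have /choice[s sP] phi : exists s : seq G, thick (ev phi) ->
    forall x, exists2 a, a \in s & ev phi (a^-1 * x)%g.
  have [/thick_cover[s sP]|nt] := pselect (thick (ev phi)); first by exists s.
  by exists [::].
pose f x : set (formula L X * nat) :=
  [set p | ev p.1 ((nth 1 (s p.1) p.2)^-1 * x)%g].
have sX : small K (set (formula L X * nat)) by exact: small_set_formula.
apply: (bounded_index_small core_group_subgroup sX (f := f)) => x y fxy.
exists 1; rewrite /core.
have key D : thick D -> exists z, D z /\ D (z^-1 * (x^-1 * y))%g.
  move=> tD; have [[phi phiD] D1 Dsym _] := tD.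
  have De : D = ev phi.
    apply/seteqP; split=> z; first by move=> Dz; have : (c @` D) (c z);
      [exists z | rewrite phiD].
    rewrite /ev /= => pz; have : (c @` D) (c z) by rewrite phiD.
    by move=> [z' Dz' e]; case: defG => cinj _ _; rewrite -(cinj _ _ e).
  rewrite De in tD; have [a sa ax] := sP phi tD x.
  have : f x (phi, index a (s phi)) by rewrite /f /= nth_index.
  rewrite fxy /f /= nth_index // => ay.
  exists (x^-1 * a)%g; rewrite De; split; last by rewrite invgM invgK -mulgA mulVKg.
  by rewrite -De -[(_ * _)%g]invgK invgM invgK; apply: Dsym; rewrite De.
have [D []//|D []//||||||z [z1 z2]] :=
  @prod_compact _ _ _ smallN satC _ _ _ defG thick thick (x^-1 * y)%g.
- exact: thickI.
- exact: thickI.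
- by exists setT; exact: thickT.
- by exists setT; exact: thickT.
- move=> D1 D2 t1 t2; have [z [[D1z _] [_ D2z]]] := key _ (thickI t1 t2).
  by exists z.
by exists z, (z^-1 * (x^-1 * y))%g; rewrite mulVKg.
Qed.

End Core.

(** * Generation in finitely many steps *)

Section Diameter.
Variables (K : Type) (L : language) (C : structure L).
Hypothesis smallN : small K nat.
Hypothesis satC : saturated K C.
Variables (G : groupType) (X : finType) (c : G -> X -> C).
Hypothesis defG : definable_group c.

(** If every set of a filter base satisfies one of finitely many monotone
    conditions, then one of these conditions holds for all of them. *)
Lemma pigeonhole_filter (T : eqType) (l : seq T) (R : T -> set G -> Prop)
    (FF : set (set G)) :
  (forall t D D', D `<=` D' -> R t D -> R t D') ->
  FF !=set0 -> (forall D D', FF D -> FF D' -> FF (D `&` D')) ->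
  (forall D, FF D -> exists2 t, t \in l & R t D) ->
  exists2 t, t \in l & forall D, FF D -> R t D.
Proof.
move=> Rmono [E FE] FI; elim: l => [|t l IH] h; first by have [] := h E FE.
have [ht|] := pselect (forall D, FF D -> R t D).
  by exists t => //; exact: mem_head.
move=> /existsNP[D0 /not_implyP[FD0 nR]].
have [D FD|t' t'l ht'] := IH; last by exists t' => //; rewrite inE t'l orbT.
have [t' + Rt'] := h _ (FI _ _ FD FD0).
rewrite inE => /orP[/eqP e|t'l].
  by case: nR; rewrite e in Rt'; apply: Rmono Rt' => x [].
by exists t' => //; apply: Rmono Rt' => x [].
Qed.

(** If a type-definable group is the union of an increasing sequence of
    type-definable symmetric sets, each containing the products of two elements of
    the preceding one, then the sequence is eventually constant. *)
Lemma tdset_union_stops (N : set G) (P : nat -> set G) :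
  subgroup N -> tdset c N -> (forall n, tdset c (P n)) ->
  (forall n, P n `<=` P n.+1) -> (forall n, setprod (P n) (P n) `<=` P n.+1) ->
  (forall n x, P n x -> P n x^-1%g) -> (forall x, N x <-> exists n, P n x) ->
  exists n, N `<=` P n.
Proof.
move=> subN /(tdsetP defG) tN tP Pincr PP PV NP.
have Ple m n : m <= n -> P m `<=` P n.
  elim: n => [|n IH]; first by rewrite leqn0 => /eqP ->.
  by rewrite leq_eqVlt => /orP[/eqP -> //|]; rewrite ltnS => /IH mn x /mn /Pincr.
pose S : choiceType := {classic set G}.
pose sat_at (p : G * S) x := (p.2 : set G) (p.1^-1 * x)%g.
(* t stands for the union of the translates p.1 * p.2 for p in t, which is required
   not to cover N; Z is then a maximal family whose finite unions of translates by
   elements of N do not cover N *)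
pose uncovered (t : seq (G * S)) :=
  exists x, N x /\ forall p, p \in t -> ~ sat_at p x.
pose Q (s : seq S) := forall t : seq (G * S),
  (forall p, p \in t -> N p.1 /\ p.2 \in s) -> uncovered t.
have Qnil : Q [::].
  move=> t ht; exists 1%g; split; first exact: subgroup1.
  by move=> p /ht[].
have [Z [goodZ maxZ]] := tukey Qnil.
have unZ (t : seq (G * S)) : (forall p, p \in t -> N p.1 /\ Z p.2) -> uncovered t.
  move=> ht; apply: (goodZ (map snd t)) => [D /mapP[p /ht[_ Zp] -> //]|p pt].
  by split; [case: (ht p pt) | exact: map_f].
have covered (D : S) : ~ Z D -> exists t : seq (G * S),
    (forall p, p \in t -> N p.1 /\ (p.2 = D \/ Z p.2)) /\
    forall x, N x -> exists2 p, p \in t & sat_at p x.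
  move=> nZD; apply: contrapT => nt; apply: nZD; apply: maxZ => s sZ t ts.
  apply: contrapT => nu; apply: nt; exists t; split=> [p /ts[Np /sZ]|x Nx] //.
  by apply: contrapT => np; apply: nu; exists x; split=> // p pt sp; apply: np; exists p.
have Znonempty (D : S) : ~ Z D -> exists y, (D : set G) y.
  move=> nZD; apply: contrapT => nD.
  have [t [tsub tcov]] := covered D nZD.
  have [|x [Nx hx]] := unZ [seq p <- t | p.2 != D].
    by move=> p; rewrite mem_filter => /andP[/eqP pD /tsub[Np []]].
  have [p pt spx] := tcov x Nx.
  case: (hx p) => //; rewrite mem_filter pt andbT; apply/eqP => pD.
  by apply: nD; exists (p.1^-1 * x)%g; rewrite -pD.
have nZN : ~ Z N.
  move=> ZN; have [|x [Nx /(_ (1%g, N))]] := unZ [:: (1%g, N)].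
    by move=> p; rewrite inE => /eqP ->; split=> //=; exact: subgroup1.
  by rewrite mem_head => /(_ isT); apply; rewrite /sat_at /= invg1 mul1g.
pose above n (psi : set G) := dset c psi /\ P n `<=` psi.
have aboveI n D D' : above n D -> above n D' -> above n (D `&` D').
  move=> [d s] [d' s']; split; first exact: dset_setI.
  by move=> x Px; split; [exact: s | exact: s'].
have aboveT n : above n setT by split=> //; exact: dset_setT.
(* a set outside Z that modulo Z is contained in each definable superset of P n;
   otherwise, removing such supersets one after the other for all n and using
   saturation would give a point of N outside every P n *)
have [n [D [nZD hD]]] : exists n (D : S), ~ Z D /\
    forall psi, above n psi -> Z ((D : set G) `\` psi).
  apply: contrapT => none.
  have /choice[ps psP] (p : nat * set G) : exists psi, ~ Z p.2 ->
      above p.1 psi /\ ~ Z (p.2 `\` psi).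
    have [Zp|nZp] := pselect (Z p.2); first by exists set0.
    apply: contrapT => npsi; apply: none; exists p.1, p.2; split=> // psi apsi.
    by apply: contrapT => nZ; apply: npsi; exists psi.
  pose fix E n : set G := if n is n'.+1
    then E n' `\` ps (n', N `&` E n') else setT.
  have nZE n : ~ Z (N `&` E n).
    elim: n => [|n IH] /=; first by rewrite setIT.
    by rewrite setIDA; exact: (psP (n, _) IH).2.
  have dE n : dset c (E n).
    elim: n => [|n IH] /=; first exact: dset_setT.
    by apply: dset_setI => //; apply: dset_setC => //; case: (psP (n, _) (nZE n)).1.
  have Ele m n : m <= n -> E n `<=` E m.
    elim: n => [|n IH]; first by rewrite leqn0 => /eqP ->.
    by rewrite leq_eqVlt => /orP[/eqP -> //|]; rewrite ltnS => /IH mn x [/mn].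
  pose F A := exists B n, [/\ dset c B, N `<=` B & A = B `&` E n].
  have [|||||x Fx] := @gsat _ _ _ smallN satC _ _ _ defG unit (fun=> 1%g) F.
  - exact: small_count.
  - move=> _ [B [n [dB NB ->]]].
    exists (fun g => B (g None) /\ E n (g None)).
    by split=> //; apply: gdef_and; apply: gdef_in.
  - move=> _ _ [B1 [n1 [d1 s1 ->]]] [B2 [n2 [d2 s2 ->]]].
    exists ((B1 `&` B2) `&` E (maxn n1 n2)).
      exists (B1 `&` B2), (maxn n1 n2); split=> //; first exact: dset_setI.
      by move=> x Nx; split; [exact: s1 | exact: s2].
    move=> x [[? ?] Ex]; split; split=> //.
      exact: Ele (leq_maxl _ _) _ Ex.
    exact: Ele (leq_maxr _ _) _ Ex.
  - move=> _ [B [n [dB NB ->]]]; have [x [Nx Ex]] := Znonempty _ (nZE n).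
    by exists x; split=> //; exact: NB.
  - by exists (setT `&` E 0), setT, 0; split=> //; exact: dset_setT.
  have /NP[n Pnx] : N x.
    by apply: tN => B dB NB; have [] : (B `&` E 0) x by apply: Fx; exists B, 0.
  have [_ [_ nps]] : (setT `&` E n.+1) x.
    by apply: Fx; exists setT, n.+1; split=> //; exact: dset_setT.
  by apply: nps; apply: (psP (n, _) (nZE n)).1.2.
(* modulo Z, the translates of D by the finite set gs cover N; so do, for each psi,
   those of psi, and two translates of this cover by 1 and g must meet *)
have [t [tsub tcov]] := covered D nZD.
pose gs := map fst t.
have gsN h : h \in gs -> N h by move=> /mapP[p /tsub[Np _] ->].
have key g : N g -> exists h1 h2, [/\ h1 \in gs, h2 \in gs & P n.+1 (h1^-1 * g * h2)%g].
  move=> Ng.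
  pose R (hh : G * G) (psi : set G) := exists x,
    psi (hh.1^-1 * x)%g /\ psi (hh.2^-1 * (g^-1 * x))%g.
  have [|||psi apsi|[h1 h2] hl Rh] := @pigeonhole_filter _
      [seq (h1, h2) | h1 <- gs, h2 <- gs] R (above n).
  - by move=> hh A A' AA' [x [A1 A2]]; exists x; split; apply: AA'.
  - by exists setT.
  - exact: aboveI.
  - pose t' : seq (G * S) := [seq (p.1, if p.2 == D then (D : set G) `\` psi else p.2) | p <- t].
    have t'Z p : p \in t' -> N p.1 /\ Z p.2.
      move=> /mapP[q /tsub[Nq qZ] ->] /=; split=> //.
      by case: eqVneq qZ => [_ _|/eqP qD [/qD|]] //; apply: hD.
    have [|x [Nx hx]] := unZ (t' ++ [seq ((g * p.1)%g, p.2) | p <- t']).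
      move=> p; rewrite mem_cat => /orP[/t'Z //|/mapP[q /t'Z[Nq Zq] ->]].
      by split=> //; exact: subgroupM.
    (* a point of N is covered by t; if it is not covered by t', it lies in one of
       the translates of psi *)
    have hit y : N y -> (forall p, p \in t' -> ~ sat_at p y) ->
        exists2 h, h \in gs & psi (h^-1 * y)%g.
      move=> Ny ny; have [p pt spy] := tcov y Ny.
      exists p.1; first exact: map_f.
      have := ny _ (map_f _ pt); rewrite /sat_at /=.
      case: eqP => [pD|_ //] npsi; apply: contrapT => np; apply: npsi.
      by split=> //; rewrite -pD.
    have [|h1 h1g p1] := hit x Nx; first by move=> p pt; apply: hx; rewrite mem_cat pt.
    have [||h2 h2g p2] := hit (g^-1 * x)%g.
    + by apply: subgroupM => //; exact: subgroupV.
    + move=> p pt spx; apply: (hx ((g * p.1)%g, p.2)).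
        by rewrite mem_cat; apply/orP; right; apply/mapP; exists p.
      by rewrite /sat_at /= invgM -mulgA.
    by exists (h1, h2); [apply/allpairsP; exists (h1, h2) | exists x].
  move: hl => /allpairsP[[k1 k2] [/= h1g h2g [e1 e2]]].
  rewrite -{k1}e1 in h1g; rewrite -{k2}e2 in h2g.
  exists h1, h2; split=> //; apply: PP.
  have [A []//|A []//||||||y [y1 y2]] := @prod_compact _ _ _ smallN satC _ _ _ defG
    (above n) (above n) (h1^-1 * g * h2)%g.
  - exact: aboveI.
  - exact: aboveI.
  - by exists setT.
  - by exists setT.
  - move=> A1 A2 a1 [d2 s2].
    have a2 : above n [set x | A2 x^-1%g].
      by split; [exact: dset_inv | move=> x /PV /s2].
    have [x [[A1x _] [_ A2x]]] := Rh _ (aboveI _ _ _ a1 a2).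
    exists (h1^-1 * x)%g; split=> //; move: A2x => /=; congr (A2 _).
    by rewrite !invgM !invgK !mulgA mulgK.
  exists y, (y^-1 * (h1^-1 * g * h2))%g; rewrite mulVKg; split=> //.
    by apply: (proj1 (tdsetP defG _) (tP n)) => A dA PA; apply: y1.
  by apply: (proj1 (tdsetP defG _) (tP n)) => A dA PA; apply: y2.
have [m gsm] : exists m, forall h, h \in gs -> P m h.
  elim: (gs) gsN => [|h l IH] lN; first by exists 0.
  have [k|m lm] := IH; first by move=> kl; apply: lN; rewrite inE kl orbT.
  have /NP[m' hm'] := lN h (mem_head _ _).
  exists (maxn m m') => k; rewrite inE => /orP[/eqP ->|/lm].
    exact: Ple (leq_maxr _ _) _ hm'.
  exact: Ple (leq_maxl _ _) _.
exists (maxn m n.+1).+2 => g /key[h1 [h2 [/gsm p1 /gsm p2 pu]]].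
have -> : g = (h1 * (h1^-1 * g * h2) * h2^-1)%g by rewrite !mulgA mulgV mul1g mulgK.
apply: (PP _.+1); exists (h1 * (h1^-1 * g * h2))%g, h2^-1%g; split=> //.
  apply: (PP (maxn m n.+1)); exists h1, (h1^-1 * g * h2)%g; split=> //.
    exact: Ple (leq_maxl _ _) _ p1.
  exact: Ple (leq_maxr _ _) _ pu.
by apply: PV; apply: Ple p2; rewrite (leq_trans (leq_maxl _ n.+1)).
Qed.

End Diameter.

(** * Group extensions *)

Section Extension.
Variables (L : language) (C : structure L).
Variables (G : groupType) (X : finType) (cG : G -> X -> C).
Hypothesis defG : definable_group cG.
Variables (A : zmodType) (Y : finType) (cA : A -> Y -> C).
Hypothesis defA : definable_abelian_group cA.
Variable E : extension_data G A.
Hypothesis def_act :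
  definable_map (coord_pair cG cA) cA (fun p => act E p.1 p.2).
Hypothesis def_cocycle :
  definable_map (coord_pair cG cG) cA (fun p => cocycle E p.1 p.2).

Local Notation c := (ext_coord E cA cG).

Let cG_inj : injective cG. Proof. by case: defG. Qed.
Let cA_inj : injective cA. Proof. by case: defA. Qed.

(** The graph of a definable map, with its arguments and its value read off
    arbitrary variables. *)
Lemma defrel_graph (P P' Q : Type) (I I' J : Type) (cP : P -> I -> C)
    (cP' : P' -> I' -> C) (cQ : Q -> J -> C) (f : P * P' -> Q)
    (V : Type) (i : I -> V) (i' : I' -> V) (j : J -> V) :
  definable_map (coord_pair cP cP') cQ f ->
  defrel (fun v : V -> C => exists p p',
    [/\ v \o i = cP p, v \o i' = cP' p' & v \o j = cQ (f (p, p'))]).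
Proof.
move=> /definableP df.
pose u (z : (I + I') + J) : V := match z with
  | inl (inl x) => i x | inl (inr x) => i' x | inr x => j x end.
apply: defrel_ext (defrel_sub u df) => v.
split=> [[[p p'] _ e]|[p [p' [e e' ej]]]].
  exists p, p'; split; apply/funext => x.
  - exact: (congr1 (@^~ (inl (inl x))) (esym e)).
  - exact: (congr1 (@^~ (inl (inr x))) (esym e)).
  - exact: (congr1 (@^~ (inr x)) (esym e)).
exists (p, p') => //; apply/funext => -[[x|x]|x] /=.
- by rewrite -e.
- by rewrite -e'.
- by rewrite -ej.
Qed.

Lemma ext_coord_inj : injective c.
Proof.
move=> [a g] [b h] e; congr pair.
  by apply: cA_inj; apply/funext => y; exact: (congr1 (@^~ (inl y)) e).
by apply: cG_inj; apply/funext => x; exact: (congr1 (@^~ (inr x)) e).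
Qed.

(** The preimage in the extension of a definable subset of [G] is definable. *)
Lemma definable_preimage (D : set G) :
  definable (cG @` D) -> definable (c @` [set x | D x.2]).
Proof.
case: defA => _ /definableP rA _ /definableP dD; apply/definableP.
apply: defrel_ext (defrel_and (defrel_sub (@inl Y X) rA)
  (defrel_sub (@inr Y X) dD)) => v.
split=> [[[a _ ea] [g Dg eg]]|[[a g] /= Dg <-]]; last first.
  by split; [exists a | exists g].
exists (a, g) => //; apply/funext => -[y|x].
  exact: (congr1 (@^~ y) ea).
exact: (congr1 (@^~ x) eg).
Qed.

(** The product of the extension is a composite of the definable maps, with three
    intermediate values in [A]. *)
Lemma definable_extension : definable_group c.
Proof.
case: (defA) => _ _ dadd; case: (defG) => _ rG dmul.
split; first exact: ext_coord_inj.
  have -> : range c = c @` [set x | [set: G] x.2] by [].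
  exact: definable_preimage.
apply/definableP.
(* b1, b2 and b3 are the coordinates of the action of g1 on a2, of its sum with a1
   and of the cocycle at g1 and g2; (a3, g3) are those of the product *)
pose V := (((Y + X) + (Y + X)) + (Y + X) + (Y + (Y + Y)))%type.
pose a1 (y : Y) : V := inl (inl (inl (inl y))).
pose g1 (x : X) : V := inl (inl (inl (inr x))).
pose a2 (y : Y) : V := inl (inl (inr (inl y))).
pose g2 (x : X) : V := inl (inl (inr (inr x))).
pose a3 (y : Y) : V := inl (inr (inl y)).
pose g3 (x : X) : V := inl (inr (inr x)).
pose b1 (y : Y) : V := inr (inl y).
pose b2 (y : Y) : V := inr (inr (inl y)).
pose b3 (y : Y) : V := inr (inr (inr y)).
have d := defrel_and (defrel_graph g1 a2 b1 def_act)
  (defrel_and (defrel_graph a1 b1 b2 dadd)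
  (defrel_and (defrel_graph g1 g2 b3 def_cocycle)
  (defrel_and (defrel_graph b2 b3 a3 dadd)
  (defrel_graph g1 g2 g3 dmul)))).
apply: defrel_ext (defrel_ex (X := (Y + (Y + Y))%type) d) => v; split; last first.
  move=> [[[x1 h1] [x2 h2]] _ <-].
  exists (sumf (cA (act E h1 x2))
    (sumf (cA (x1 + act E h1 x2)%R) (cA (cocycle E h1 h2)))).
  split; [by exists h1, x2 | split; [by exists x1, (act E h1 x2) | split]].
    by exists h1, h2.
  split; last by exists h1, h2.
  by exists (x1 + act E h1 x2)%R, (cocycle E h1 h2).
move=> [b [[h1 [x2 [e1 e2 e3]]] [[x1 [y1 [e4 e5 e6]]] [[h1' [h2 [e7 e8 e9]]]
  [[y2 [y3 [e10 e11 e12]]] [h1'' [h2' [e13 e14 e15]]]]]]]].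
have q1 : h1' = h1 by apply: cG_inj; rewrite -e7 -e1.
have q2 : h1'' = h1 by apply: cG_inj; rewrite -e13 -e1.
have q3 : h2' = h2 by apply: cG_inj; rewrite -e14 -e8.
have q4 : y1 = act E h1 x2 by apply: cA_inj; rewrite -e5 e3.
have q5 : y2 = (x1 + y1)%R by apply: cA_inj; rewrite -e10 e6.
have q6 : y3 = cocycle E h1' h2 by apply: cA_inj; rewrite -e11 e9.
subst.
exists ((x1, h1), (x2, h2)) => //; apply/funext => -[[[t|t]|[t|t]]|[t|t]].
- exact: (congr1 (@^~ t) (esym e4)).
- exact: (congr1 (@^~ t) (esym e1)).
- exact: (congr1 (@^~ t) (esym e2)).
- exact: (congr1 (@^~ t) (esym e8)).
- exact: (congr1 (@^~ t) (esym e12)).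
- exact: (congr1 (@^~ t) (esym e15)).
Qed.

Lemma invariant_preimage (D : set G) :
  aut_invariant (cG @` D) -> aut_invariant (c @` [set x | D x.2]).
Proof.
move=> invD s auts _ [[a g] Dg <-].
have [|h Dh eh] := invD s auts (cG g); first by exists g.
have rA : aut_invariant (range cA).
  case: defA => _ [phi ->] _ t autt w; exact: (proj2 (sat_automorphism autt phi w)).
have [|b _ eb] := rA s auts (cA a); first by exists a.
exists (b, h) => //; apply/funext => -[y|x].
  exact: (congr1 (@^~ y) eb).
exact: (congr1 (@^~ x) eh).
Qed.

Lemma subgroup_preimage (D : set G) :
  subgroup D -> subgroup [set x : extension E | D x.2].
Proof.
move=> sD; apply: subgroupI => /=; first exact: (subgroup1 sD).
  by move=> x y; exact: (subgroupM sD).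
by move=> x; exact: (subgroupV sD).
Qed.

Lemma bounded_index_preimage (K : Type) (D : set G) : subgroup D ->
  bounded_index K D -> bounded_index K [set x : extension E | D x.2].
Proof.
move=> sD /(bounded_index_inv sD)[T [f [sT fD]]].
apply: (bounded_index_small (subgroup_preimage sD) sT (f := fun x => f x.2)).
by move=> x y /fD.
Qed.

Lemma bounded_index_image (K : Type) (S : set (extension E)) : subgroup S ->
  bounded_index K S -> forall D : set G, subgroup D ->
  (forall x, S x -> D x.2) -> bounded_index K D.
Proof.
move=> sS /(bounded_index_inv sS)[T [f [sT fS]]] D sD SD.
apply: (bounded_index_small sD sT (f := fun g => f (0%R, g))).
by move=> x y /fS /SD.
Qed.

End Extension.

Theorem corollary5p7 (K : Type) (L : language) (C : structure L)
    (monsterC : monster K C)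
    (G : groupType) (X : finType) (cG : G -> X -> C)
    (defG : definable_group cG)
    (A : zmodType) (Y : finType) (cA : A -> Y -> C)
    (defA : definable_abelian_group cA)
    (E : extension_data G A)
    (def_act : definable_map (coord_pair cG cA) cA (fun p => act E p.1 p.2))
    (def_cocycle :
       definable_map (coord_pair cG cG) cA (fun p => cocycle E p.1 p.2))
    (H : set (extension E))
    (subH : subgroup H)
    (invH : aut_invariant (ext_coord E cA cG @` H))
    (bdH : bounded_index K H)
    (compG : comp00 K cG = comp000 K cG)
    (tdef : type_definable
       (ext_coord E cA cG @`
          (H `&` ext_ker E `&` comp00 K (ext_coord E cA cG)))) :
  comp00 K (ext_coord E cA cG) `&` ext_ker E `<=` H `&` ext_ker E.
Proof.
set c := ext_coord E cA cG in invH tdef *; set N := comp00 K c in tdef *.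
case: monsterC => _ sF satC homC; have sN := small_nat sF.
have defE : definable_group c by exact: definable_extension.
pose S := core_group c; pose F := core c; pose ker := ext_ker E.
have sS : subgroup S := core_group_subgroup c.
have bdS : bounded_index K S by exact: core_group_bounded.
have FS n : F n `<=` S by move=> x Fx; exists n.
have Smin (H' : set (extension E)) : subgroup H' -> aut_invariant (c @` H') ->
    bounded_index K H' -> S `<=` H' by exact: core_group_sub.
have SH : S `<=` H by exact: Smin.
have SN : S `<=` N.
  by move=> x Sx H' [[sH' tH' bH'] _]; apply: Smin Sx => //;
     exact: type_definable_invariant.
have subN : subgroup N.
  apply: subgroupI; first by apply: SN; exact: subgroup1.
    move=> x y Nx Ny H' CH'; have [[sH' _ _] _] := CH'.
    by apply: (subgroupM sH'); [exact: Nx | exact: Ny].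
  move=> x Nx H' CH'; have [[sH' _ _] _] := CH'.
  by apply: (subgroupV sH'); exact: Nx.
(* the image of S in G is the smallest invariant subgroup of bounded index *)
pose I : set G := [set x.2 | x in S].
have sI : subgroup I.
  apply: subgroupI; first by exists 1%g => //; exact: subgroup1.
    by move=> _ _ [x Sx <-] [y Sy <-]; exists (x * y)%g => //; exact: subgroupM.
  by move=> _ [x Sx <-]; exists x^-1%g => //; exact: subgroupV.
have bI : bounded_index K I by apply: (bounded_index_image sS bdS) => // x Sx; exists x.
have invI : aut_invariant (cG @` I).
  move=> s auts _ [_ [x Sx <-] <-].
  have invS := core_group_invariant sN satC defE.
  have [|y Sy ey] := invS s auts (c x); first by exists x.
  exists y.2; first by exists y.
  by apply/funext => z; exact: (congr1 (@^~ (inr z)) ey).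
have I00 : comp00 K cG = I.
  rewrite compG; apply: smallest_least => // H' [sH' iH' bH'] _ [x Sx <-].
  apply: (Smin [set x | H' x.2]) Sx; first exact: subgroup_preimage.
    exact: invariant_preimage.
  exact: bounded_index_preimage.
pose N0 : set (extension E) := [set x | I x.2].
have sN0 : subgroup N0 by exact: subgroup_preimage.
have tI : tdset cG I.
  rewrite -I00; apply: (tdset_bigcap defG) => M [[_ tM _] _]; exact: tM.
have tN0 : tdset c N0.
  apply/(tdsetP defE) => x hx; apply: (proj1 (tdsetP defG I) tI) => D dD ID.
  apply: (hx [set x | D x.2]); first exact: definable_preimage.
  by move=> y /ID.
have tker : tdset c ker.
  apply: (dset_tdset defE).
  by apply: (definable_preimage defA E (D := [set 1%g])); exact: dset_set1.
pose P n := setprod (F n) ker.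
have kerJ x k : ker k -> ker (x * k * x^-1)%g.
  by move=> kk; have : (x.2 * k.2 * x.2^-1 = 1)%g by rewrite kk mulg1 mulgV.
have kerM x y : ker x -> ker y -> ker (x * y)%g.
  by move=> kx ky; have : (x.2 * y.2 = 1)%g by rewrite kx ky mulg1.
have kerV x : ker x -> ker x^-1%g.
  by move=> kx; have : (x.2^-1 = 1)%g by rewrite kx invg1.
have [n N0P] : exists n, N0 `<=` P n.
  apply: (tdset_union_stops sN satC defE) => //.
  - move=> n; apply: (tdset_prod sN satC defE) => //.
    exact: (core_tdset sN satC defE).
  - move=> n x [f [k [Ff kk ->]]]; exists f, k; split=> //.
    exact: core_le Ff.
  - move=> n _ [_ [_ [[f [k [Ff kk ->]]] [f' [k' [Ff' kk' ->]]] ->]]].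
    exists (f * f')%g, ((f'^-1 * k * f'^-1^-1) * k')%g; split.
    + by exists f, f'.
    + by apply: kerM => //; exact: kerJ.
    + by rewrite invgK !mulgA mulgK.
  - move=> n _ [f [k [Ff kk ->]]]; exists f^-1%g, (f * k^-1 * f^-1)%g; split.
    + exact: coreV.
    + by apply: kerJ; exact: kerV.
    + by rewrite invgM !mulgA mulVg mul1g.
  - move=> x; split=> [[y [n Fy] yx]|[n [f [k [Ff kk ->]]]]].
      exists n, y, (y^-1 * x)%g; rewrite mulVKg; split=> //.
      by have : (y.2^-1 * x.2 = 1)%g by rewrite yx mulVg.
    exists f; first by exists n.
    by have -> : (f * k)%g.2 = (f.2 * k.2)%g by []; rewrite kk mulg1.
have NN0 : N `<=` N0.
  by apply: smallest_sub => //; split=> //; exact: bounded_index_preimage.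
have HN : H `&` N = setprod (F n) (H `&` ker `&` N).
  apply/seteqP; split=> [x [Hx Nx]|_ [f [k [Ff [[Hk kk] Nk] ->]]]]; last first.
    split; first by apply: (subgroupM subH) => //; exact: SH _ (FS n _ Ff).
    by apply: (subgroupM subN) => //; exact: SN _ (FS n _ Ff).
  have [f [k [Ff kk xfk]]] := N0P _ (NN0 _ Nx).
  have ke : k = (f^-1 * x)%g by rewrite xfk mulKg.
  exists f, k; split=> //; split; last first.
    by rewrite ke; apply: (subgroupM subN) => //; exact: (subgroupV subN (SN _ (FS n _ Ff))).
  split=> //; rewrite ke; apply: (subgroupM subH) => //.
  exact: (subgroupV subH (SH _ (FS n _ Ff))).
have sHN : subgroup (H `&` N).
  apply: subgroupI.
  - by split; [exact: (subgroup1 subH) | exact: (subgroup1 subN)].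
  - move=> x y [Hx Nx] [Hy Ny].
    by split; [exact: (subgroupM subH) | exact: (subgroupM subN)].
  - move=> x [Hx Nx].
    by split; [exact: (subgroupV subH) | exact: (subgroupV subN)].
have NHN : N `<=` H `&` N.
  apply: smallest_sub => //; split=> //.
    rewrite HN; apply: (tdset_prod sN satC defE) => //.
    exact: (core_tdset sN satC defE).
  by apply: bounded_index_sub bdS => // x Sx; split; [exact: SH | exact: SN].
by move=> x [/NHN[Hx _] kx].
Qed.
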